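(* Let $\Omega\subset\mathbb{R}$ be a compact region (a closed bounded interval), let $\Theta\subset\mathbb{R}^d$ be open, and let $(\Omega,\Theta,\rho)$ be a statistical model in which each $\rho(\cdot,\theta)$ is a positive smooth probability density on $\Omega$. Suppose the ground-truth density satisfies $\rho^*=\rho(\cdot,\theta^* )$ for some $\theta^*\in\Theta$. Let $F(\cdot,\theta)$ be the cumulative distribution function of $\rho(\cdot,\theta)$, let $T(\cdot,\theta)$ be the optimal transport map from $\rho(\cdot,\theta)$ to $\rho^*$ for the cost $|x-y|^2$, and let $T'(x,\theta)$ denote its derivative in $x$. Suppose that: (1) for each $\theta\in\Theta$ and each $\xi\in\mathbb{R}^d$ the Neumann problem $-(\rho(x,\theta)\Phi'(x))'=\langle\nabla_\theta\rho(x,\theta),\xi\rangle$ in $\Omega$, $\Phi'=0$ on $\partial\Omega$, has a smooth solution $\Phi$ with $\int_\Omega\rho(x,\theta)|\Phi'(x)|^2dx<+\infty$; (2) for every $\theta_0\in\Theta$ there is a neighborhood $N(\theta_0)\subset\Theta$ such that for all $1\le i,j\le d$ $$\int_\Omega\max_{\theta\in N(\theta_0)}\Big|\frac{\partial^2F(x,\theta)}{\partial\theta_i\partial\theta_j}\Big|dx<+\infty,\quad \int_\Omega\max_{\theta\in N(\theta_0)}\Big|\frac{\partial\rho(x,\theta)}{\partial\theta_i}\Big|dx<+\infty,\quad \int_\Omega\max_{\theta\in N(\theta_0)}\frac{1}{\rho(x,\theta)}\Big|\frac{\partial F(x,\theta)}{\partial\theta_i}\frac{\partial F(x,\theta)}{\partial\theta_j}\Big|dx<+\infty;$$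 (3) for each fixed $\theta$, $T'(x,\theta)$ is uniformly bounded in $x$. Let $R(\rho(\cdot,\theta))=\frac12\left(W_2(\rho(\cdot,\theta),\rho^* )\right)^2$. Then $$\lim_{\theta\to\theta^*}\nabla^2_\theta R(\rho(\cdot,\theta))=\int_\Omega\frac{1}{\rho(x,\theta^* )}(\nabla_\theta F(x,\theta^* ))^T\nabla_\theta F(x,\theta^* )\,dx=G_W(\theta^* ).$$
   Context: A statistical model $(\Omega,\Theta,\rho)$ consists of a sample space $\Omega$, a parameter space $\Theta\subset\mathbb{R}^d$, and a map $\theta\mapsto\rho(\cdot,\theta)$ into probability densities on $\Omega$; densities are assumed smooth in $x$ and to depend smoothly on $\theta$. $F(x,\theta)=\int_{\Omega\cap(-\infty,x]}\rho(y,\theta)\,dy$. $W_2$ is the $L^2$-Wasserstein distance: $(W_2(\rho^0,\rho^1))^2=\min_\pi\int_{\Omega\times\Omega}|x-y|^2d\pi(x,y)$ over couplings $\pi$ of $\rho^0$ and $\rho^1$. In one dimension the optimal map is $T(x,\theta)=F_*^{-1}(F(x,\theta))$, where $F_*$ is the cumulative distribution function of $\rho^*$. $\nabla_\theta F$ is the Euclidean gradient in $\theta$ written as a row vector, so $(\nabla_\theta F)^T\nabla_\theta F$ is a $d\times d$ matrix; $\nabla^2_\theta$ is the Hessian in $\theta$. $G_W(\theta)$ is the matrix of the $L^2$-Wasserstein metric tensor on $\Theta$ (with Euclidean coordinates): for $\xi,\eta\in\mathbb{R}^d$, $\xi^TG_W(\theta)\eta=\int_\Omega\rho(x,\theta)\Phi_\xi'(x)\Phi_\eta'(x)\,dx$,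 where $\Phi_\xi$ (and likewise $\Phi_\eta$) is a solution of the Neumann problem in hypothesis (1) for the vector $\xi$ (resp. $\eta$). *)

(* Defs.v *)
From mathcomp Require Import all_boot all_order all_algebra.
From mathcomp Require Import all_classical all_reals all_analysis.
Export numFieldNormedType.Exports.

Set Implicit Arguments.
Unset Strict Implicit.
Unset Printing Implicit Defensive.
Import Order.TTheory GRing.Theory Num.Theory.

Local Open Scope ring_scope.
Local Open Scope classical_set_scope.

(* A parametric family is encoded as [rho : R -> 'rV[R]_d -> R]; only its values
   on [a, b] x Theta are ever constrained or used. *)

Definition smooth (R : realType) (f : R -> R) : Prop :=
  forall (n : nat) (x : R), derivable (derive1n n f) x 1.

(* Smoothness up to the boundary, as extendability to a smooth function on R. *)
Definition smooth_itv (R : realType) (a b : R) (f : R -> R) : Prop :=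
  exists2 g : R -> R, smooth g & forall x, a <= x <= b -> f x = g x.

Definition partial (R : realType) (d : nat) (i : 'I_d) (f : 'rV[R]_d -> R) :
    'rV[R]_d -> R :=
  'D_(delta_mx 0 i : 'rV[R]_d) f.

Definition has_partial (R : realType) (d : nat) (i : 'I_d)
    (f : 'rV[R]_d -> R) (t : 'rV[R]_d) : Prop :=
  derivable f t (delta_mx 0 i : 'rV[R]_d).

(* C^infinity on an open set: iterated partial derivatives of every order are
   differentiable, hence also continuous. *)
Definition smooth_param (R : realType) (d : nat) (U : set 'rV[R]_d)
    (f : 'rV[R]_d -> R) : Prop :=
  forall (s : seq 'I_d) (t : 'rV[R]_d), U t ->
    differentiable (foldr (@partial R d) f s) t.

Definition gradient (R : realType) (d : nat) (f : 'rV[R]_d -> R)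
    (t : 'rV[R]_d) : 'rV[R]_d :=
  \row_i partial i f t.

Definition hessian (R : realType) (d : nat) (f : 'rV[R]_d -> R)
    (t : 'rV[R]_d) : 'M[R]_d :=
  \matrix_(i, j) partial i (partial j f) t.

(* derive is a total operator, so existence has to be recorded separately. *)
Definition has_hessian (R : realType) (d : nat) (f : 'rV[R]_d -> R)
    (t : 'rV[R]_d) : Prop :=
  forall i j : 'I_d, has_partial j f t /\ has_partial i (partial j f) t.

Definition mx_integral (R : realType) (m n : nat) (D : set R)
    (A : R -> 'M[R]_(m, n)) : 'M[R]_(m, n) :=
  \matrix_(i, j) \int[@lebesgue_measure R]_(x in D) A x i j.

Record statistical_model (R : realType) (d : nat) (a b : R)
    (Theta : set 'rV[R]_d) (rho : R -> 'rV[R]_d -> R) : Prop :=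
  StatisticalModel {
    model_open : open Theta ;
    model_pos : forall t x, Theta t -> a <= x <= b -> 0 < rho x t ;
    model_mass : forall t, Theta t ->
      (\int[@lebesgue_measure R]_(x in `[a, b]) (rho x t)%:E = 1)%E ;
    model_smooth_x : forall t, Theta t -> smooth_itv a b (fun x => rho x t) ;
    model_smooth_t : forall x, a <= x <= b -> smooth_param Theta (rho x) }.

Definition model_cdf (R : realType) (d : nat) (a b : R) (rho : R -> 'rV[R]_d -> R)
    (x : R) (t : 'rV[R]_d) : R :=
  \int[@lebesgue_measure R]_(y in `[a, b] `&` `]-oo, x]) rho y t.

(* The law on [a, b] with density f, extended by zero to the Borel sets of R. *)
Definition law (R : realType) (a b : R) (f : R -> R) (A : set R) : \bar R :=
  (\int[@lebesgue_measure R]_(x in `[a, b] `&` A) (f x)%:E)%E.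

Definition coupling (R : realType) (a b : R) (f g : R -> R)
    (p : probability (measurableTypeR R * measurableTypeR R)%type R) : Prop :=
  forall A : set (measurableTypeR R), measurable A ->
    p (A `*` setT) = law a b f A /\ p (setT `*` A) = law a b g A.

(* The infimum is attained; couplings are supported on [a, b] x [a, b]. *)
Definition W2 (R : realType) (a b : R) (f g : R -> R) : R :=
  Num.sqrt (fine (ereal_inf
    [set (\int[p]_(z in `[a, b] `*` `[a, b]) (`|z.1 - z.2| ^+ 2)%:E)%E
      | p in coupling a b f g])).

Definition optimal_map (R : realType) (a b : R) (f g : R -> R) (T : R -> R) :
    Prop :=
  [/\ measurable_fun (`[a, b] : set (measurableTypeR R))
        (T : measurableTypeR R -> measurableTypeR R),
      (forall A : set (measurableTypeR R), measurable A ->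
         law a b f (T @^-1` A) = law a b g A) &
      (\int[@lebesgue_measure R]_(x in `[a, b]) (`|x - T x| ^+ 2 * f x)%:E
         = (W2 a b f g ^+ 2)%:E)%E].

(* - (rho Phi')' = <grad_theta rho, xi> in the interior, Phi' = 0 at both ends;
   Phi ranges over smooth functions on R, Phi' on [a, b] being independent of
   the extension. *)
Definition neumann_solution (R : realType) (d : nat) (a b : R)
    (rho : R -> 'rV[R]_d -> R) (t : 'rV[R]_d) (xi : 'cV[R]_d)
    (Phi : R -> R) : Prop :=
  [/\ smooth Phi,
      (forall x, a < x < b ->
         - derive1 (fun y => rho y t * derive1 Phi y) x
         = (gradient (rho x) t *m xi) 0 0),
      derive1 Phi a = 0 &
      derive1 Phi b = 0].

(* Determines G as soon as the Neumann problem is solvable for every vector. *)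
Definition is_wasserstein_tensor (R : realType) (d : nat) (a b : R)
    (rho : R -> 'rV[R]_d -> R) (t : 'rV[R]_d) (G : 'M[R]_d) : Prop :=
  forall (xi eta : 'cV[R]_d) (Phi Psi : R -> R),
    neumann_solution a b rho t xi Phi ->
    neumann_solution a b rho t eta Psi ->
    (xi^T *m G *m eta) 0 0
    = \int[@lebesgue_measure R]_(x in `[a, b])
        (rho x t * derive1 Phi x * derive1 Psi x).

(* The supremum is taken in the extended reals, so it need not be attained. *)
Definition sup_integrable (R : realType) (d : nat) (a b : R)
    (N : set 'rV[R]_d) (h : R -> 'rV[R]_d -> R) : Prop :=
  (@lebesgue_measure R).-integrable `[a, b]
    (fun x => ereal_sup [set (`|h x t|)%:E | t in N]).

Definition risk (R : realType) (d : nat) (a b : R) (rho : R -> 'rV[R]_d -> R)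
    (ts t : 'rV[R]_d) : R :=
  2^-1 * W2 a b (fun x => rho x t) (fun x => rho x ts) ^+ 2.

(* Main.v *)
From HB Require Import structures.
Require Import Defs.
From mathcomp Require Import all_boot all_order all_algebra.
From mathcomp Require Import all_classical all_reals all_analysis.
From mathcomp Require Import measurable_realfun lra ring.
Import Order.TTheory GRing.Theory Num.Theory.
Local Open Scope ring_scope.
Local Open Scope classical_set_scope.

(** For a coupling p of two laws on [a, b] with distribution functions F and G,
    writing b - x and (b - x)^2 as integrals of indicators of {x <= u} gives
      cost p = int 2 (b - u) F(u) du + int 2 (b - u) G(u) du
               - 2 int int p(x <= u, y <= v) du dv.
    Since p(x <= u, y <= v) <= min (F u) (G v), with equality for the monotone
    coupling, W2^2 / 2 is, up to a term independent of F,
      int (b - u) F(u) - psi (F u) du   with   psi s = int min s (G v) dv,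
    and psi' s = b - G^-1(s).  Hence, with T = G^-1 o F(., t),
      d_j R = int (T - x) d_j F,
      d_i d_j R = int d_i F d_j F / rho_*(T) + int (T - x) d_i d_j F.
    The bound on d_i rho makes the d_i F uniformly bounded, and rho_* is bounded
    below, so dominated convergence applies; as t -> t_* one has T -> x, which
    kills the second integral.  Finally the Neumann problem integrates to
    rho Phi' = - <grad F, xi>. *)

Set Implicit Arguments.
Unset Strict Implicit.
Unset Printing Implicit Defensive.

(** The risk is never differentiated through a transport plan. Once the infimum over couplings is an
    explicit integral, the parameter enters its integrand only through the number F(x, t), so each
    derivative is one-variable calculus in that number followed by differentiation under the
    integral. Two obstacles shape the work. [F x] is handled through its partial derivatives alone.
    The chain rule and differentiation under the integral are therefore carried out along lines,
    continuity of [F x] at the truth comes from a mean value bound on rho, and the second partials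
    of F are controlled only by a bound, which suffices because they are multiplied by T - x. The
    suprema of the hypotheses live in the extended reals and bound derivatives only off a null set.
    This set is deleted from the domains of integration, so that domination holds at every remaining
    point. *)

Lemma EFin_Rintegral disp (T : measurableType disp) (R : realType)
    (m : {measure set T -> \bar R}) (D : set T) (h : T -> R) :
  measurable D -> m.-integrable D (EFin \o h) ->
  (\int[m]_(x in D) (h x)%:E)%E = (\int[m]_(x in D) h x)%:E.
Proof.
by move=> mD ih; rewrite /Rintegral fineK//; exact: (integrable_fin_num mD ih).
Qed.

Lemma integrable_EFinB disp (T : measurableType disp) (R : realType)
    (m : {measure set T -> \bar R}) (D : set T) (f g : T -> R) :
  measurable D -> m.-integrable D (EFin \o f) -> m.-integrable D (EFin \o g) ->
  m.-integrable D (EFin \o (fun x => f x - g x)).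
Proof.
by move=> mD mf mg; apply: eq_integrable (integrableB mD mf mg).
Qed.

Lemma integrable_EFinZ disp (T : measurableType disp) (R : realType)
    (m : {measure set T -> \bar R}) (D : set T) (c : R) (f : T -> R) :
  measurable D -> m.-integrable D (EFin \o f) ->
  m.-integrable D (EFin \o (fun x => c * f x)).
Proof.
by move=> mD fi; apply: eq_integrable (integrableZl mD c fi).
Qed.

Lemma integrable_EFin_sum disp (T : measurableType disp) (R : realType)
    (m : {measure set T -> \bar R}) (D : set T) (I : Type) (s : seq I)
    (f : I -> T -> R) :
  measurable D -> (forall i, m.-integrable D (EFin \o f i)) ->
  m.-integrable D (EFin \o (fun x => \sum_(i <- s) f i x)).
Proof.
move=> mD fi; apply: eq_integrable (integrable_sum mD s (fun i _ => fi i)) => //.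
by move=> x _; rewrite /= sumEFin.
Qed.

Lemma Rintegral_sum disp (T : measurableType disp) (R : realType)
    (m : {measure set T -> \bar R}) (D : set T) (I : Type) (s : seq I)
    (f : I -> T -> R) :
  measurable D -> (forall i, m.-integrable D (EFin \o f i)) ->
  \int[m]_(x in D) (\sum_(i <- s) f i x) = \sum_(i <- s) \int[m]_(x in D) f i x.
Proof.
move=> mD fi; elim: s => [|i s IHs].
  rewrite big_nil; under eq_Rintegral do rewrite big_nil.
  by rewrite Rintegral_cst// mul0r.
rewrite big_cons -IHs -RintegralD//; last exact: integrable_EFin_sum.
by apply: eq_Rintegral => x _; rewrite big_cons.
Qed.

Lemma Rintegral_setD_null (R : realType) (D Z : set R) (f : R -> R) :
  measurable (D : set (measurableTypeR R)) ->
  measurable (Z : set (measurableTypeR R)) ->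
  @lebesgue_measure R Z = 0%E -> (@lebesgue_measure R).-integrable D (EFin \o f) ->
  \int[@lebesgue_measure R]_(x in D) f x =
  \int[@lebesgue_measure R]_(x in D `\` Z) f x.
Proof.
by move=> mD mZ Z0 fi; rewrite /Rintegral (negligible_integral mZ mD fi Z0).
Qed.

(** * Distribution functions and quantiles *)

(** What the transport argument takes from a smooth model density. Continuity is phrased through an
    extension to the line so that it includes both endpoints. *)
Definition is_density (R : realType) (a b : R) (f : R -> R) : Prop :=
  [/\ (exists2 g : R -> R, continuous g & {in `[a, b]%R, f =1 g}),
      (forall x, a <= x <= b -> 0 < f x) &
      (\int[@lebesgue_measure R]_(x in `[a, b]) (f x)%:E = 1)%E].

(** Convertible with [model_cdf] at a frozen parameter, so results on a single density apply to the
    model as they stand. *)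
Definition cdf_on (R : realType) (a b : R) (f : R -> R) (x : R) : R :=
  \int[@lebesgue_measure R]_(y in `[a, b] `&` `]-oo, x]) f y.

Section density.
Context (R : realType) (a b : R) (f : R -> R).
Hypotheses (ab : a < b) (df : is_density a b f).
Notation mu := (@lebesgue_measure R).
Let F := cdf_on a b f.

Lemma density_continuous_within : {within `[a, b], continuous f}.
Proof.
have [[g cg fg] _ _] := df.
apply: (@subspace_eq_continuous _ _ _ g).
  by move=> x; rewrite inE => xab; apply/esym/fg.
exact: continuous_subspaceT.
Qed.

Lemma density_integrable : mu.-integrable `[a, b] (EFin \o f).
Proof.
apply: continuous_compact_integrable; first exact: segment_compact.
exact: density_continuous_within.
Qed.

Lemma density_continuous x : a < x < b -> {for x, continuous f}.
Proof.
move=> xab; have [[g cg fg] _ _] := df.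
apply: cvg_trans; last first.
  rewrite (fg x); first exact: cg.
  by rewrite in_itv/=; case/andP: xab => /ltW-> /ltW->.
apply: near_eq_cvg; near=> y; apply/esym/fg; rewrite in_itv/=.
have : y \in `]a, b[%R by near: y; apply: near_in_itvoo; rewrite in_itv.
by rewrite in_itv/= => /andP[? ?]; rewrite !ltW.
Unshelve. all: by end_near. Qed.

Lemma cdf_on_segment x : x <= b -> F x = \int[mu]_(y in `[a, x]) f y.
Proof.
move=> xb; rewrite /F /cdf_on; congr (Rintegral _ _ _).
apply/seteqP; split => y /=; rewrite !in_itv/=.
  by move=> [/andP[-> _] ->].
by move=> /andP[-> yx]; rewrite yx (le_trans yx xb).
Qed.

Lemma cdf_on_le x : x <= a -> F x = 0.
Proof.
move=> xa; rewrite cdf_on_segment; last exact: le_trans xa (ltW ab).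
move: xa; rewrite le_eqVlt => /predU1P[->|xa].
  by rewrite set_itv1 Rintegral_set1.
by rewrite set_itv_ge ?Rintegral_set0// bnd_simp -ltNge.
Qed.

Lemma cdf_on_ge x : b <= x -> F x = 1.
Proof.
move=> bx; rewrite /F /cdf_on (_ : _ `&` _ = `[a, b]); last first.
  apply/seteqP; split => y /=; rewrite !in_itv/=; first by case.
  by move=> /andP[-> yb]; rewrite yb (le_trans yb bx).
by have [_ _ m1] := df; rewrite /Rintegral m1.
Qed.

Lemma law_ray x : law a b f `]-oo, x] = (F x)%:E.
Proof.
rewrite /law /F /cdf_on /Rintegral fineK//.
apply: integrable_fin_num; first exact: measurableI.
by apply: (integrableS _ _ _ density_integrable) => //; exact: measurableI.
Qed.

Lemma is_derive_cdf_on x : a < x < b -> is_derive x 1 F (f x).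
Proof.
move=> xab.
have /andP[ax xb] := xab.
have [dF dFE] := @continuous_FTC1_closed R f a x b xb density_integrable ax
  (density_continuous xab).
apply: (@near_eq_is_derive _ _ _ (fun x => \int[mu]_(t in `[a, x]) f t)).
- near=> y; apply/esym/cdf_on_segment.
  have : y \in `]a, b[%R by near: y; apply: near_in_itvoo; rewrite in_itv.
  by rewrite in_itv/= => /andP[_ /ltW].
- by apply: DeriveDef => //; rewrite -derive1E.
Unshelve. all: by end_near. Qed.

Lemma cdf_on_continuous_within : {within `[a, b], continuous F}.
Proof.
apply: (@subspace_eq_continuous _ _ _ (fun x => parameterized_integral mu a x f)).
  by move=> x; rewrite inE/= in_itv/= => /andP[_ xb]; exact/esym/cdf_on_segment.
apply: parameterized_integral_continuous; [exact: ltW|exact: density_integrable].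
Qed.

Lemma cdf_on_lt x y : a <= x -> y <= b -> x < y -> F x < F y.
Proof.
move=> ax yb xy.
apply: (@gtr0_derive1_lt_cc R F a b) => //.
- by move=> z; rewrite in_itv/= => /is_derive_cdf_on[].
- move=> z; rewrite in_itv/= => zab; rewrite derive1E.
  have [_ ->] := is_derive_cdf_on zab.
  by have [_ + _] := df; apply; case/andP: zab => /ltW-> /ltW->.
- exact: cdf_on_continuous_within.
- by rewrite in_itv/= ax (le_trans (ltW xy) yb).
- by rewrite in_itv/= yb (le_trans ax (ltW xy)).
Qed.

Lemma cdf_on_nd x y : x <= y -> F x <= F y.
Proof.
move=> xy; have [xa|ax] := leP x a.
  rewrite (cdf_on_le xa); apply: Rintegral_ge0 => z [/=].
  by rewrite in_itv/= => zab _; apply/ltW; have [_ + _] := df; apply.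
have [yb|by_] := leP y b.
  move: xy; rewrite le_eqVlt => /predU1P[->//|xy].
  by apply/ltW/cdf_on_lt => //; exact: ltW.
rewrite (cdf_on_ge (ltW by_)).
have [xb|bx] := leP x b; last by rewrite cdf_on_ge// ltW.
move: xb; rewrite le_eqVlt => /predU1P[->|xb]; first by rewrite cdf_on_ge.
by rewrite -(@cdf_on_ge b)//; apply/ltW/cdf_on_lt => //; exact: ltW.
Qed.

Lemma cdf_on_ge0 x : 0 <= F x.
Proof.
have [xa|/ltW ax] := leP x a; first by rewrite cdf_on_le.
by rewrite -(@cdf_on_le a)//; exact: cdf_on_nd.
Qed.

Lemma cdf_on_le1 x : F x <= 1.
Proof.
have [xa|/ltW ax] := leP x b; last by rewrite cdf_on_ge.
by rewrite -(@cdf_on_ge b)//; exact: cdf_on_nd.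
Qed.

Lemma cdf_on_mono : {in `[a, b]%R &, {mono F : x y / x <= y}}.
Proof.
apply: le_mono_in => x y; rewrite !in_itv/= => /andP[ax _] /andP[_ yb].
exact: cdf_on_lt.
Qed.

(** The guard on [s] sits inside the existential, so that choice yields a total function, arbitrary
    outside [0, 1]. Inside, the intermediate value theorem applies because [F] runs from 0 to 1. *)
Lemma quantile_ex s : exists x, 0 <= s <= 1 -> a <= x <= b /\ F x = s.
Proof.
have [s01|] := boolP (0 <= s <= 1); last by exists 0.
have [|x xab Fx] := @IVT R F a b s (ltW ab) cdf_on_continuous_within.
  rewrite cdf_on_le// cdf_on_ge// /Num.min /Num.max ltr01//.
by exists x => _; rewrite in_itv/= in xab.
Qed.

Definition quantile s := sval (cid (quantile_ex s)).
Notation Q := quantile.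

Lemma quantile_itv s : 0 <= s <= 1 -> a <= Q s <= b.
Proof. by move=> s01; rewrite /Q; case: cid => x /= /(_ s01)[]. Qed.

Lemma quantileK s : 0 <= s <= 1 -> F (Q s) = s.
Proof. by move=> s01; rewrite /Q; case: cid => x /= /(_ s01)[]. Qed.

Lemma cdf_onK x : a <= x <= b -> Q (F x) = x.
Proof.
move=> xab; have F01 : 0 <= F x <= 1 by rewrite cdf_on_ge0 cdf_on_le1.
by apply: (inc_inj_in cdf_on_mono); rewrite ?in_itv/= ?quantile_itv ?quantileK.
Qed.

Lemma quantile_le s x : 0 <= s <= 1 -> a <= x <= b -> (Q s <= x) = (s <= F x).
Proof.
move=> s01 xab; rewrite -{2}(quantileK s01).
by rewrite cdf_on_mono// in_itv/= ?quantile_itv.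
Qed.

Lemma quantile_oo s : 0 < s < 1 -> a < Q s < b.
Proof.
move=> /andP[s0 s1]; have s01 : 0 <= s <= 1 by rewrite !ltW.
have /andP[aQ Qb] := quantile_itv s01.
rewrite !lt_neqAle aQ Qb !andbT; apply/andP; split.
  by apply/eqP => Qa; move: s0; rewrite -(quantileK s01) -Qa cdf_on_le// ltxx.
by apply/eqP => Qa; move: s1; rewrite -(quantileK s01) Qa cdf_on_ge// ltxx.
Qed.

(** Inverse function rule at [Q s]. The values 0 and 1 are excluded: there [Q s] is an endpoint,
    beyond which [F] is constant, and [F] has no two-sided derivative. *)
Lemma is_derive_quantile (s : R) : 0 < s < 1 -> is_derive s 1 Q (f (Q s))^-1.
Proof.
move=> s01; have Qs := quantile_oo s01.
have {1}-> : s = F (Q s).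
  by rewrite quantileK//; case/andP: s01 => /ltW-> /ltW->.
have near_ab : \forall x \near Q s, x \in `]a, b[%R.
  by apply: near_in_itvoo; rewrite in_itv.
apply: is_derive_inverse.
- near=> x; apply: cdf_onK.
  have : x \in `]a, b[%R by near: x.
  by rewrite in_itv/= => /andP[/ltW-> /ltW->].
- near=> x.
  have : x \in `]a, b[%R by near: x.
  rewrite in_itv/= => /is_derive_cdf_on[/derivable1_diffP + _].
  exact: differentiable_continuous.
- exact: is_derive_cdf_on.
- rewrite gt_eqF//; have [_ + _] := df; apply.
  by case/andP: Qs => /ltW-> /ltW->.
Unshelve. all: by end_near. Qed.

End density.

(** * The cost of a coupling *)

(** Tonelli for [h z * w u] on the region where [X z <= u <= b]. The freedom in [D], [h] and [w]
    allows weight 2 (b - u) for the second moments and two nested applications with weight 1 for the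
    mixed moment. Measurability of [L] is returned too, because comparing such integrals for two
    couplings requires it. *)
Lemma layer_cake disp (T : measurableType disp) (R : realType)
    (p : probability T R) (a b : R) (D : set T) (X h : T -> R) (w : R -> R) :
  measurable D -> measurable_fun setT X -> (forall z, D z -> a <= X z <= b) ->
  measurable_fun setT h -> (forall z, D z -> 0 <= h z) ->
  measurable_fun setT w -> (forall u, a <= u <= b -> 0 <= w u) ->
  let L u := ((w u)%:E *
    \int[p]_(z in D `&` [set z | (X z <= u)%R]) (h z)%:E)%E in
  measurable_fun `[a, b] L /\
  (\int[p]_(z in D)
     ((h z)%:E * \int[@lebesgue_measure R]_(u in `[X z, b]) (w u)%:E) =
   \int[@lebesgue_measure R]_(u in `[a, b]) L u)%E.
Proof.
move=> mD mX Xab mh h0 mw w0 L.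
pose E := [set zu : T * measurableTypeR R |
  [/\ D zu.1, a <= zu.2 <= b & X zu.1 <= zu.2]].
have mE : measurable E.
  have -> : E = (D `*` `[a, b]) `&` [set zu | X zu.1 <= zu.2].
    apply/seteqP; split => -[z u] /=; rewrite in_itv/=; first by case.
    by case=> -[].
  apply: measurable_fun_le.
  - exact: measurableX.
  - by apply: measurable_funTS; exact: measurableT_comp mX _.
  - exact: measurable_funTS.
pose f := (fun zu => (h zu.1 * w zu.2)%:E) \_ E : T * measurableTypeR R -> \bar R.
have f0 zu : (0 <= f zu)%E.
  apply: erestrict_ge0 => {}zu [Dz uab _].
  by rewrite lee_fin mulr_ge0 ?h0 ?w0.
have mf : measurable_fun setT f.
  apply/(measurable_restrictT _ mE); apply: measurable_funTS.
  apply/measurable_EFinP/measurable_funM; first exact: measurableT_comp mh _.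
  exact: measurableT_comp mw _.
have GE u : fubini_G p f u = (L \_ `[a, b]) u.
  rewrite /fubini_G patchE; case: ifPn => [|uab].
    rewrite inE/= in_itv/= => uab.
    rewrite /L -ge0_integralZl_EFin ?w0//; last 3 first.
    - by apply: (measurable_fun_le (g := cst u)) => //; exact: measurable_funTS.
    - by move=> z [Dz _]; rewrite lee_fin h0.
    - by apply/measurable_EFinP; exact: measurable_funTS.
    rewrite [RHS]integral_mkcond; apply: eq_integral => z _.
    rewrite /f !patchE; have -> : ((z, u) \in E) = (z \in D `&` [set z | X z <= u]).
      by apply/idP/idP; rewrite !inE /E /=; [case|case=> *; split].
    by case: ifP => // _; rewrite mulrC EFinM.
  apply: integral0_eq => z _; rewrite /f patchE; case: ifPn => //.
  rewrite inE => -[/= _ + _]; move: uab; rewrite notin_setE/= in_itv/=.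
  by move=> + uab.
have FE z : fubini_F (@lebesgue_measure R) f z =
   ((fun z => ((h z)%:E * \int[@lebesgue_measure R]_(u in `[X z, b]) (w u)%:E)%E)
     \_ D) z.
  rewrite /fubini_F patchE; case: ifPn => [|Dz].
    rewrite inE => Dz; have /andP[aX Xb] := Xab _ Dz.
    rewrite -ge0_integralZl_EFin ?h0//; last 2 first.
    - move=> u /=; rewrite in_itv/= lee_fin => /andP[Xu ub]; apply: w0.
      by rewrite ub (le_trans aX).
    - by apply/measurable_EFinP; exact: measurable_funTS.
    rewrite [RHS]integral_mkcond; apply: eq_integral => u _.
    rewrite /f !patchE; have -> // : ((z, u) \in E) = (u \in `[X z, b]).
      apply/idP/idP; rewrite !inE /E /= in_itv/=.
        by case=> _ /andP[_ ->] ->.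
      by move=> /andP[Xu ub]; rewrite ub Xu (le_trans aX Xu).
  apply: integral0_eq => u _; rewrite /f patchE; case: ifPn => //.
  by rewrite inE => -[/= Dz' _ _]; move: Dz; rewrite notin_setE.
split.
  apply: (iffRL (measurable_restrictT _ _)); first exact: measurable_itv.
  rewrite -(_ : fubini_G p f = L \_ _); last exact/funext.
  exact: measurable_fun_fubini_tonelli_G.
rewrite [LHS]integral_mkcond [RHS]integral_mkcond.
under eq_integral do rewrite -FE.
under [RHS]eq_integral do rewrite -GE.
exact: fubini_tonelli.
Qed.

Lemma integral_tail_cst (R : realType) (x b : R) : x <= b ->
  (\int[@lebesgue_measure R]_(u in `[x, b]) (1 : R)%:E = (b - x)%:E)%E.
Proof.
move=> xb.
rewrite [LHS](integral_cst (@lebesgue_measure R) (measurable_itv _) 1%:E) mul1e.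
rewrite [LHS](lebesgue_measure_itv `[x, b]%R) /= lte_fin.
by case: ltgtP xb => // -> _; rewrite subrr.
Qed.

Lemma integral_tail_linear (R : realType) (x b : R) : x <= b ->
  (\int[@lebesgue_measure R]_(u in `[x, b]) (2 * (b - u))%:E
   = ((b - x) ^+ 2)%:E)%E.
Proof.
rewrite le_eqVlt => /predU1P[->|xb].
  by rewrite set_itv1 integral_set1 subrr expr0n.
have dG (y : R) : is_derive y 1 (fun u : R => - (b - u) ^+ 2) (2 * (b - y)).
  by apply: is_derive_eq; rewrite /GRing.scale/=; ring.
have cG : continuous (fun u : R => - (b - u) ^+ 2).
  move=> y; apply: differentiable_continuous.
  by apply/derivable1_diffP; case: (dG y).
rewrite (@continuous_FTC2 R _ (fun u => - (b - u) ^+ 2)) => //.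
- by rewrite -EFinB; congr EFin; ring.
- apply: continuous_subspaceT => y; apply: cvgM; first exact: cvg_cst.
  by apply: cvgB; [exact: cvg_cst|exact: cvg_id].
- split.
  + by move=> y _; case: (dG y).
  + exact/cvg_at_right_filter/cG.
  + exact/cvg_at_left_filter/cG.
- by move=> y _; rewrite derive1E; case: (dG y).
Qed.

Section coupling_cost.
Context (R : realType) (a b : R) (f g : R -> R).
Hypotheses (ab : a < b) (df : is_density a b f) (dg : is_density a b g).
Variable p : probability (measurableTypeR R * measurableTypeR R)%type R.
Hypothesis pfg : coupling a b f g p.
Notation mu := (@lebesgue_measure R).
Notation F := (cdf_on a b f).
Notation G := (cdf_on a b g).
Let S : set (measurableTypeR R * measurableTypeR R) := `[a, b] `*` `[a, b].

Let mS : measurable S. Proof. exact: measurableX. Qed.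

Let law_outside h : law a b h (~` `[a, b]) = 0%E.
Proof. by rewrite /law setICr integral_set0. Qed.

(** A point outside the square lies in one of two strips, each null because the marginals are
    carried by [a, b]. *)
Lemma coupling_null : p (~` S) = 0%E.
Proof.
have mC : measurable (~` `[a, b] : set (measurableTypeR R)) by exact: measurableC.
apply/eqP; rewrite -measure_le0.
have [p1 _] := pfg mC; have [_ p2] := pfg mC.
rewrite (@le_trans _ _ (p ((~` `[a, b]) `*` setT `|` setT `*` (~` `[a, b]))))//.
  apply: le_measure; rewrite ?inE; [exact: measurableC| |].
    by apply: measurableU; exact: measurableX.
  move=> [x y] /= /not_andP[xy|xy]; [by left|by right].
rewrite (le_trans (measureU2 _ _ _)) //; [exact: measurableX|exact: measurableX|].
by rewrite [X in (X + _)%E](etrans p1 (law_outside _))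
  [X in (_ + X)%E](etrans p2 (law_outside _)) adde0.
Qed.

(** Marginals are prescribed on full strips while the cost is integrated over the square; this
    passes from one to the other. *)
Lemma coupling_setI A : measurable A -> p (S `&` A) = p A.
Proof.
move=> mA; rewrite [RHS](@measureDI _ _ _ p A S) // setIC.
rewrite [X in (_ = X + _)%E](_ : _ = 0%E) ?add0e//.
apply/eqP; rewrite -measure_le0 -[leRHS]coupling_null.
apply: le_measure; rewrite ?inE; [exact: measurableD|exact: measurableC|].
by move=> z [].
Qed.

Let mle1 u : measurable [set z : measurableTypeR R * measurableTypeR R | z.1 <= u].
Proof.
rewrite (_ : [set _ | _] = `]-oo, u] `*` setT); first exact: measurableX.
by apply/seteqP; split=> -[x y] /=; rewrite in_itv//= => -[].
Qed.

Let mle2 u : measurable [set z : measurableTypeR R * measurableTypeR R | z.2 <= u].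
Proof.
rewrite (_ : [set _ | _] = setT `*` `]-oo, u]); first exact: measurableX.
by apply/seteqP; split=> -[x y] /=; rewrite in_itv//= => -[].
Qed.

Lemma coupling_fst u : p (S `&` [set z | z.1 <= u]) = (F u)%:E.
Proof.
rewrite coupling_setI// -(law_ray df).
have [<- _] := pfg (measurable_itv `]-oo, u]%R).
by congr (p _); apply/seteqP; split=> -[x y] /=; rewrite in_itv//= => -[].
Qed.

Lemma coupling_snd u : p (S `&` [set z | z.2 <= u]) = (G u)%:E.
Proof.
rewrite coupling_setI// -(law_ray dg).
have [_ <-] := pfg (measurable_itv `]-oo, u]%R).
by congr (p _); apply/seteqP; split=> -[x y] /=; rewrite in_itv//= => -[].
Qed.

(** The intersections are nested as two successive uses of [layer_cake] produce them, in [z.1] and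
    then in [z.2]. *)
Definition joint_cdf u v : \bar R :=
  p ((S `&` [set z | z.1 <= u]) `&` [set z | z.2 <= v]).

(** The Frechet-Hoeffding upper bound: dropping either of the two constraints enlarges the event and
    leaves a marginal. *)
Lemma joint_cdf_le u v : (joint_cdf u v <= (Num.min (F u) (G v))%:E)%E.
Proof.
rewrite /joint_cdf; have mSu : measurable (S `&` [set z | z.1 <= u]).
  exact: measurableI.
have mSuv : measurable ((S `&` [set z | z.1 <= u]) `&` [set z | z.2 <= v]).
  exact: measurableI.
have mSv : measurable (S `&` [set z | z.2 <= v]) by exact: measurableI.
have [_|_] := leP (F u) (G v).
  by rewrite -coupling_fst; apply: le_measure; rewrite ?inE//; exact: subIsetl.
rewrite -coupling_snd; apply: le_measure; rewrite ?inE//.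
by move=> z [[]].
Qed.

Let integral_indic1 D : measurable D -> (\int[p]_(z in D) (1 : R)%:E = p D)%E.
Proof. by move=> mD; rewrite [LHS](integral_cst p mD 1%:E) mul1e. Qed.

Let Sab1 z : S z -> a <= z.1 <= b. Proof. by case; rewrite /= in_itv. Qed.
Let Sab2 z : S z -> a <= z.2 <= b. Proof. by case=> _; rewrite /= in_itv. Qed.

Let b2_ge0 z : S z -> 0 <= b - z.2.
Proof. by case=> _; rewrite /= in_itv/= subr_ge0 => /andP[]. Qed.

Let mb2 : measurable_fun setT
  (fun z : measurableTypeR R * measurableTypeR R => b - z.2).
Proof. by apply: measurable_funB => //; exact: measurable_snd. Qed.

Let m1 : measurable_fun setT
  (fst : measurableTypeR R * measurableTypeR R -> R).
Proof. exact: measurable_fst. Qed.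

Let m2 : measurable_fun setT
  (snd : measurableTypeR R * measurableTypeR R -> R).
Proof. exact: measurable_snd. Qed.

Lemma joint_cdf_integral u :
  measurable_fun `[a, b] (joint_cdf u) /\
  (\int[p]_(z in S `&` [set z | (z.1 <= u)%R]) (b - z.2)%:E =
   \int[mu]_(v in `[a, b]) joint_cdf u v)%E.
Proof.
have mD : measurable (S `&` [set z | z.1 <= u]) by exact: measurableI.
have Dab z : (S `&` [set z | z.1 <= u]) z -> a <= z.2 <= b by move=> [/Sab2].
have [mL IL] := @layer_cake _ _ R p a b (S `&` [set z | z.1 <= u]) snd (cst 1)
  (cst 1) mD m2 Dab (measurable_cst _) (fun _ _ => ler01) (measurable_cst _)
  (fun _ _ => ler01).
have LE v : ((cst 1 v)%:E * \int[p]_(z in (S `&` [set z | (z.1 <= u)%R]) `&`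
    [set z | (z.2 <= v)%R]) (cst 1 z)%:E)%E = joint_cdf u v.
  by rewrite mul1e integral_indic1//; exact: measurableI.
split.
  by apply: eq_measurable_fun mL => v _; rewrite LE.
under [RHS]eq_integral do rewrite -LE.
rewrite -IL; apply: eq_integral => z; rewrite inE => -[/Sab2/andP[_ zb] _].
by rewrite integral_tail_cst// mul1e.
Qed.

(** Hoeffding's formula for the mixed moment. The outer layer cake cuts in [z.1] and keeps [b - z.2]
    as integrand; the inner one is [joint_cdf_integral]. *)
Lemma joint_cdf_integral2 :
  measurable_fun `[a, b]
    (fun u => \int[mu]_(v in `[a, b]) joint_cdf u v)%E /\
  (\int[p]_(z in S) ((b - z.2) * (b - z.1))%:E =
   \int[mu]_(u in `[a, b]) \int[mu]_(v in `[a, b]) joint_cdf u v)%E.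
Proof.
have [mL IL] := @layer_cake _ _ R p a b S fst (fun z => b - z.2)
  (cst 1) mS m1 Sab1 mb2 b2_ge0 (measurable_cst _) (fun _ _ => ler01).
have LE u : ((cst 1 u)%:E * \int[p]_(z in S `&` [set z | (z.1 <= u)%R])
    (b - z.2)%:E = \int[mu]_(v in `[a, b]) joint_cdf u v)%E.
  by rewrite mul1e; have [_ ->] := joint_cdf_integral u.
split.
  by apply: eq_measurable_fun mL => v _; rewrite LE.
under [RHS]eq_integral do rewrite -LE.
rewrite -IL; apply: eq_integral => z; rewrite inE => /Sab1/andP[_ zb].
by rewrite integral_tail_cst// EFinM.
Qed.

Let mw : measurable_fun setT (fun u : R => 2 * (b - u)).
Proof. by apply: measurable_funM => //; exact: measurable_funB. Qed.

Let w0 (u : R) : a <= u <= b -> 0 <= 2 * (b - u).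
Proof. by move=> /andP[_ ub]; rewrite mulr_ge0// subr_ge0. Qed.

Lemma second_moment1 :
  (\int[p]_(z in S) ((b - z.1) ^+ 2)%:E =
   \int[mu]_(u in `[a, b]) (2 * (b - u) * F u)%:E)%E.
Proof.
have [_ IL] := @layer_cake _ _ R p a b S fst (cst 1)
  (fun u => 2 * (b - u)) mS m1 Sab1 (measurable_cst _) (fun _ _ => ler01)
  mw w0.
transitivity (\int[mu]_(u in `[a, b]) ((2 * (b - u))%:E *
    \int[p]_(z in S `&` [set z | (z.1 <= u)%R]) (cst 1 z)%:E))%E; last first.
  apply: eq_integral => u _; rewrite EFinM integral_indic1 ?coupling_fst//.
  exact: measurableI.
rewrite -IL; apply: eq_integral => z; rewrite inE => /Sab1/andP[_ zb].
by rewrite integral_tail_linear// mul1e.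
Qed.

Lemma second_moment2 :
  (\int[p]_(z in S) ((b - z.2) ^+ 2)%:E =
   \int[mu]_(u in `[a, b]) (2 * (b - u) * G u)%:E)%E.
Proof.
have [_ IL] := @layer_cake _ _ R p a b S snd (cst 1)
  (fun u => 2 * (b - u)) mS m2 Sab2 (measurable_cst _) (fun _ _ => ler01)
  mw w0.
transitivity (\int[mu]_(u in `[a, b]) ((2 * (b - u))%:E *
    \int[p]_(z in S `&` [set z | (z.2 <= u)%R]) (cst 1 z)%:E))%E; last first.
  apply: eq_integral => u _; rewrite EFinM integral_indic1 ?coupling_snd//.
  exact: measurableI.
rewrite -IL; apply: eq_integral => z; rewrite inE => /Sab2/andP[_ zb].
by rewrite integral_tail_linear// mul1e.
Qed.

(** Integrated form of (x - y)^2 + 2 (b - x)(b - y) = (b - x)^2 + (b - y)^2. The mixed term stays on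
    the left, so that all terms are nonnegative and nothing is subtracted in the extended reals. *)
Lemma coupling_costE :
  (\int[p]_(z in S) (`|z.1 - z.2| ^+ 2)%:E +
   2%:E * \int[mu]_(u in `[a, b]) \int[mu]_(v in `[a, b]) joint_cdf u v =
   \int[mu]_(u in `[a, b]) (2 * (b - u) * F u)%:E +
   \int[mu]_(u in `[a, b]) (2 * (b - u) * G u)%:E)%E.
Proof.
have mb1 : measurable_fun setT
    (fun z : measurableTypeR R * measurableTypeR R => b - z.1).
  by apply: measurable_funB => //; exact: measurable_fst.
have prod_ge0 z : S z -> 0 <= (b - z.2) * (b - z.1).
  by move=> Sz; rewrite mulr_ge0 ?b2_ge0// subr_ge0; case/andP: (Sab1 Sz).
have [_ <-] := joint_cdf_integral2.
rewrite -second_moment1 -second_moment2 -ge0_integralZl_EFin//; last first.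
  by apply/measurable_EFinP; apply: measurable_funTS; exact: measurable_funM.
rewrite -!ge0_integralD//; first 1 last.
- by move=> z _; rewrite lee_fin sqr_ge0.
- by apply/measurable_EFinP; apply: measurable_funTS; exact: measurable_funX.
- by move=> z _; rewrite lee_fin sqr_ge0.
- by apply/measurable_EFinP; apply: measurable_funTS; exact: measurable_funX.
- by apply/measurable_EFinP; apply: measurable_funTS; apply: measurable_funX;
    apply: measurableT_comp => //; exact: measurable_funB.
- by move=> z Sz; rewrite -EFinM lee_fin mulr_ge0// prod_ge0.
- apply/measurable_EFinP; apply: measurable_funTS; apply: measurable_funM => //.
  exact: measurable_funM.
apply: eq_integral => z _; rewrite -EFinM -!EFinD real_normK ?num_real//.
by congr EFin; ring.
Qed.

End coupling_cost.

(** * The monotone coupling and the Wasserstein distance *)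

(** Half-open intervals are differences of rays, and a Lebesgue-Stieltjes measure is determined by
    its values on them; a probability is the one attached to its own distribution function. *)
Lemma probability_eq_rays (R : realType)
    (m1 m2 : probability (measurableTypeR R) R) :
  (forall x, m1 `]-oo, x] = m2 `]-oo, x]) ->
  forall A, measurable A -> m1 A = m2 A.
Proof.
move=> mE A mA; rewrite -(lebesgue_stieltjes_cdf_id m1 mA).
apply: lebesgue_stieltjes_measure_unique => // X [[x y]] _ <- /=.
rewrite lebesgue_stieltjes_cdf_id; last exact: measurable_itv.
have [xy | yx] := leP x y; last first.
  by rewrite set_itv_ge ?measure0// bnd_simp -leNgt ltW.
have : `]x, y]%classic = `]-oo, y] `\` `]-oo, x] => [|->].
  by rewrite -[RHS]setCK setCD setCitvl setUC -[LHS]setCK setCitv.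
have sub : `]-oo, x] `<=` `]-oo, y] by exact: subset_itvl.
rewrite !measureD//; last 2 first.
- by rewrite -ge0_fin_numE// fin_num_measure.
- by rewrite -ge0_fin_numE// fin_num_measure.
by rewrite (setIidr sub); congr (_ - _)%E; exact: mE.
Qed.

Section law_probability.
Context (R : realType) (a b : R) (f : R -> R) (df : is_density a b f).

(* The vacuous dependency on [df] lets the measure and probability instances
   below use positivity and total mass. *)
Definition density_law : set (measurableTypeR R) -> \bar R :=
  let _ := df in law a b f.

Let f0 x : (`[a, b] : set R) x -> (0 <= (f x)%:E)%E.
Proof.
rewrite /= in_itv/= => xab.
by have [_ fp _] := df; rewrite lee_fin ltW// fp.
Qed.

Let density_law0 : density_law set0 = 0%E.
Proof. by rewrite /density_law /law setI0 integral_set0. Qed.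

Let density_law_ge0 A : (0 <= density_law A)%E.
Proof. by apply: integral_ge0 => x [xab _]; exact: f0. Qed.

Let density_law_sigma_additive : semi_sigma_additive density_law.
Proof.
move=> A mA tA mUA; rewrite [X in _ --> X](_ : _ =
    \sum_(0 <= i <oo) density_law (A i))%E; last first.
  rewrite {1}/density_law /law setI_bigcupr ge0_integral_bigcup//.
  - by move=> k; exact: measurableI.
  - apply: (@measurable_funS _ _ _ _ `[a, b]) => //.
      by move=> x [k _ []].
    by case/integrableP: (density_integrable df).
  - by move=> x [k _ [xab _]]; exact: f0.
  - exact: trivIset_setIl.
apply: is_cvg_ereal_nneg_natsum => k _; exact: density_law_ge0.
Qed.

HB.instance Definition _ := isMeasure.Build _ _ _ density_law
  density_law0 density_law_ge0 density_law_sigma_additive.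

Let density_lawT : density_law [set: measurableTypeR R] = 1%:E.
Proof. by rewrite /density_law /law setIT; case: df. Qed.

HB.instance Definition _ := @Measure_isProbability.Build _ _ R
  density_law density_lawT.

End law_probability.

(** For [s] in [0, 1] this is the integral over [0, s] of [b] minus the quantile of [g]. The form
    with [Num.min] is the one that the Frechet-Hoeffding bound delivers. *)
Definition truncated_cdf_integral (R : realType) (a b : R) (g : R -> R) (s : R)
    : R :=
  \int[@lebesgue_measure R]_(v in `[a, b]) Num.min s (cdf_on a b g v).

Section truncated_cdf_integral.
Context (R : realType) (a b : R) (g : R -> R).
Hypotheses (ab : a < b) (dg : is_density a b g).
Notation mu := (@lebesgue_measure R).
Notation G := (cdf_on a b g).
Notation Q := (quantile ab dg).
Notation psi := (truncated_cdf_integral a b g).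

Lemma integrable_truncated_cdf s :
  mu.-integrable `[a, b] (EFin \o (fun v => Num.min s (G v))).
Proof.
apply: continuous_compact_integrable; first exact: segment_compact.
move=> x; apply: (@continuous_min R (subspace `[a, b])
  (fun _ => s : R^o) (G : _ -> R^o)); first exact: cvg_cst.
exact: cdf_on_continuous_within.
Qed.

(** [Num.min] is 1-Lipschitz in its first argument. The resulting continuity covers the levels 0 and
    1 as well, which the derivative formula below leaves out. *)
Lemma truncated_cdf_integral_lipschitz s t :
  `|psi s - psi t| <= `|s - t| * (b - a).
Proof.
rewrite /truncated_cdf_integral -RintegralB//; try exact: integrable_truncated_cdf.
have iB : mu.-integrable `[a, b]
    (EFin \o (fun v => Num.min s (G v) - Num.min t (G v))).
  by apply: integrable_EFinB => //; exact: integrable_truncated_cdf.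
apply: le_trans (le_normr_Rintegral _ iB) _ => //.
have -> : `|s - t| * (b - a) = \int[mu]_(v in `[a, b]) `|s - t|.
  rewrite Rintegral_cst// [X in _ = _ * fine X](lebesgue_measure_itv `[a, b]%R).
  by rewrite /= lte_fin ab.
apply: le_Rintegral => //.
- exact: integrable_norm.
- apply: continuous_compact_integrable; first exact: segment_compact.
  by move=> x; exact: cvg_cst.
move=> v _; rewrite /Num.min; case: ifPn; case: ifPn; rewrite -?leNgt => h1 h2.
all: rewrite ler_norml; have := ler_norm (s - t); have := ler_norm (t - s);
  rewrite (distrC t s); lra.
Qed.

Lemma truncated_cdf_integral_continuous : continuous psi.
Proof.
move=> s; apply/cvgrPdist_le => e e0.
have ba : 0 < b - a by rewrite subr_gt0.
near=> t; apply: le_trans (truncated_cdf_integral_lipschitz _ _) _.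
rewrite -ler_pdivlMr//; near: t.
by apply: cvgr_dist_le; [exact: cvg_id|exact: divr_gt0].
Unshelve. all: by end_near. Qed.

(** Cut at [Q s], where [G] crosses the level [s]: the minimum is [G] to the left and [s] to the
    right. *)
Lemma truncated_cdf_integralE (s : R) : 0 <= s <= 1 ->
  psi s = \int[mu]_(v in `[a, Q s]) G v + s * (b - Q s).
Proof.
move=> s01; have /andP[aQ Qb] := quantile_itv ab dg s01.
have := @Rintegral_itvB R (fun v => Num.min s (G v)) (BLeft a) (BRight b) (Q s)
  (integrable_truncated_cdf s).
rewrite !bnd_simp => /(_ aQ Qb)/eqP; rewrite subr_eq => /eqP.
rewrite -/(psi s) => ->; rewrite addrC; congr (_ + _).
  apply: eq_Rintegral => v; rewrite inE/= in_itv/= => /andP[_ vQ].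
  by apply/min_idPr; rewrite -[leRHS](quantileK ab dg s01); exact: cdf_on_nd.
rewrite (@eq_Rintegral _ _ _ mu _ (cst s)).
  rewrite Rintegral_cst// [X in _ * fine X](lebesgue_measure_itv `]Q s, b]%R).
  rewrite /= lte_fin; case: ltgtP Qb => // -> _.
  by rewrite subrr.
move=> v; rewrite inE/= in_itv/= => /andP[/ltW Qv _].
by apply/min_idPl; rewrite -[leLHS](quantileK ab dg s01); exact: cdf_on_nd.
Qed.

(** Moving the cut point contributes nothing: the integral yields s Q'(s), which cancels the - s
    Q'(s) coming from the second term. *)
Lemma is_derive_truncated_cdf_integral (s : R) : 0 < s < 1 ->
  is_derive s 1 psi (b - Q s).
Proof.
move=> s01; have /andP[aQ Qb] := quantile_oo ab dg s01.
have s01' : 0 <= s <= 1 by case/andP: s01 => /ltW-> /ltW->.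
have dQ := is_derive_quantile ab dg s01.
apply: (@near_eq_is_derive _ _ _
  (fun s => \int[mu]_(v in `[a, Q s]) G v + s * (b - Q s))).
  near=> t; apply/esym/truncated_cdf_integralE.
  have : t \in `]0, 1[%R by near: t; apply: near_in_itvoo; rewrite in_itv.
  by rewrite in_itv/= => /andP[/ltW-> /ltW->].
have iG : mu.-integrable `[a, b] (EFin \o G).
  apply: continuous_compact_integrable; first exact: segment_compact.
  exact: cdf_on_continuous_within.
have cG : {for Q s, continuous G}.
  apply: differentiable_continuous; apply/derivable1_diffP.
  by case: (is_derive_cdf_on dg (quantile_oo ab dg s01)).
have [dJ JE] := @continuous_FTC1_closed R G a (Q s) b Qb iG aQ cG.
pose J x := \int[mu]_(v in `[a, x]) G v.
have dJ' : is_derive (Q s) 1 J s.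
  by apply: DeriveDef => //; rewrite -derive1E JE quantileK.
have dJQ : is_derive s 1 (J \o Q) (s * (g (Q s))^-1).
  exact: is_derive1_comp.
apply: is_derive_eq.
by rewrite /GRing.scale/= mulr1; ring.
Unshelve. all: by end_near. Qed.

End truncated_cdf_integral.

Section optimal_coupling.
Context (R : realType) (a b : R) (f g : R -> R).
Hypotheses (ab : a < b) (df : is_density a b f) (dg : is_density a b g).
Notation mu := (@lebesgue_measure R).
Notation F := (cdf_on a b f).
Notation G := (cdf_on a b g).

Definition monotone_map (x : R) : R := quantile ab dg (F x).
Notation T := monotone_map.

Let F01 x : 0 <= F x <= 1.
Proof. by rewrite (cdf_on_ge0 ab df) (cdf_on_le1 ab df). Qed.

Lemma monotone_map_itv x : a <= T x <= b.
Proof. exact: quantile_itv. Qed.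

Lemma monotone_map_le x v : a <= v <= b -> (T x <= v) = (F x <= G v).
Proof. by move=> vab; rewrite /T quantile_le. Qed.

Lemma measurable_monotone_map : measurable_fun setT T.
Proof.
apply: nondecreasing_measurable => // x y xy.
by rewrite monotone_map_le ?monotone_map_itv// /T quantileK// cdf_on_nd.
Qed.

(** With [w] chosen so that F w = G v, the condition T x <= v becomes x <= w on [a, b], and the
    event is a single ray. *)
Lemma law_monotone_map u v : a <= v <= b ->
  law a b f [set x | x <= u /\ T x <= v] = (Num.min (F u) (G v))%:E.
Proof.
move=> vab; have G01 : 0 <= G v <= 1.
  by rewrite (cdf_on_ge0 ab dg) (cdf_on_le1 ab dg).
pose w := quantile ab df (G v).
have wab : a <= w <= b by exact: quantile_itv.
have Fw : F w = G v by exact: quantileK.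
have -> : law a b f [set x | x <= u /\ T x <= v] =
          law a b f `]-oo, Num.min u w].
  rewrite /law; congr integral; apply/seteqP; split => x /=.
    rewrite !in_itv/= le_min => -[xab [-> ]].
    rewrite monotone_map_le// -Fw => Fxw; split => //.
    by rewrite -(cdf_on_mono ab df).
  rewrite !in_itv/= le_min => -[xab /andP[-> xw]]; split => //; split => //.
  by rewrite monotone_map_le// -Fw cdf_on_nd.
rewrite (law_ray df) -Fw; congr EFin.
rewrite /Num.min; case: ltgtP => [uw|wu|->]; last by rewrite ltxx.
- have := cdf_on_nd ab df (ltW uw); rewrite le_eqVlt => /predU1P[->|->//].
  by rewrite ltxx.
- by have := cdf_on_nd ab df (ltW wu); rewrite leNgt => /negbTE ->.
Qed.

Let P : probability (measurableTypeR R) R := density_law df.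

Let graph_map (x : measurableTypeR R) : measurableTypeR R * measurableTypeR R :=
  (x, T x).

Let measurable_graph_map : measurable_fun setT graph_map.
Proof.
apply: measurable_fun_pair; first exact: measurable_id.
exact: measurable_monotone_map.
Qed.

HB.instance Definition _ := @isMeasurableFun.Build _ _ _ _ graph_map
  measurable_graph_map.

Let transport (x : measurableTypeR R) : measurableTypeR R := T x.

HB.instance Definition _ := @isMeasurableFun.Build _ _
  (measurableTypeR R) (measurableTypeR R) transport measurable_monotone_map.

Definition monotone_coupling :
    probability (measurableTypeR R * measurableTypeR R)%type R :=
  distribution P (graph_map : {RV P >-> _}).

(** It is enough to test rays. One ending in [a, b] is [law_monotone_map] at u = b; any other has
    empty or full preimage, since [T] takes its values in [a, b]. *)
Lemma law_monotone_map_preimage (A : set (measurableTypeR R)) : measurable A ->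
  law a b f (T @^-1` A) = law a b g A.
Proof.
pose P1 : probability (measurableTypeR R) R :=
  distribution P (transport : {RV P >-> _}).
pose P2 : probability (measurableTypeR R) R := density_law dg.
apply: (@probability_eq_rays R P1 P2) => v.
rewrite [RHS](law_ray dg).
have -> : P1 `]-oo, v] = law a b f (T @^-1` `]-oo, v]) by [].
have [va|av] := ltP v a.
  rewrite (cdf_on_le _ ab)// ?ltW// (_ : _ @^-1` _ = set0).
    by rewrite /law setI0 integral_set0.
  rewrite -subset0 => x /=; rewrite in_itv/=.
  by have /andP[aT _] := monotone_map_itv x; rewrite leNgt (lt_le_trans va aT).
have [bv|vb] := ltP b v.
  rewrite (cdf_on_ge dg)// ?ltW// (_ : _ @^-1` _ = setT).
    by rewrite /law setIT; case: df.
  rewrite -subTset => x _ /=; rewrite in_itv/=.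
  by have /andP[_ Tb] := monotone_map_itv x; rewrite (le_trans Tb)// ltW.
have vab : a <= v <= b by rewrite av.
have := law_monotone_map b vab.
rewrite (cdf_on_ge df)// min_r ?(cdf_on_le1 ab dg)// => <-.
rewrite /law; congr integral; apply/seteqP; split => x /=; rewrite !in_itv/=.
  by move=> [/andP[-> ->] ->].
by move=> [-> []].
Qed.

Lemma monotone_couplingP : coupling a b f g monotone_coupling.
Proof.
move=> A mA; split; last first.
  rewrite -(law_monotone_map_preimage mA).
  rewrite [LHS](_ : _ = law a b f (graph_map @^-1` (setT `*` A)))//.
  by congr (law a b f _); apply/seteqP; split => x //= -[].
rewrite [LHS](_ : _ = law a b f (graph_map @^-1` (A `*` setT)))//.
by congr (law a b f _); apply/seteqP; split => x //= -[].
Qed.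

(** The Frechet-Hoeffding bound is attained for all [u] and [v] at once, which is why this coupling
    is optimal. *)
Lemma joint_cdf_monotone u v : a <= v <= b ->
  joint_cdf a b monotone_coupling u v = (Num.min (F u) (G v))%:E.
Proof.
move=> vab; rewrite -(law_monotone_map u vab) /joint_cdf.
rewrite [LHS](_ : _ = law a b f (graph_map @^-1`
  (((`[a, b] `*` `[a, b]) `&` [set z | z.1 <= u]) `&` [set z | z.2 <= v])))//.
rewrite /law; congr integral; apply/seteqP; split => x /=.
  by move=> [xab [[_ xu] Tv]].
move=> [xab [xu Tv]]; do 4!split => //.
by rewrite in_itv/= monotone_map_itv.
Qed.

End optimal_coupling.

(** * Closed formula for the squared Wasserstein distance *)

Section W2_formula.
Context (R : realType) (a b : R) (f g : R -> R).
Hypotheses (ab : a < b) (df : is_density a b f) (dg : is_density a b g).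
Notation mu := (@lebesgue_measure R).
Notation F := (cdf_on a b f).
Notation G := (cdf_on a b g).
Notation psi := (truncated_cdf_integral a b g).

Lemma integrable_segment (h : R -> R) : {within `[a, b], continuous h} ->
  mu.-integrable `[a, b] (EFin \o h).
Proof.
by move=> ch; apply: continuous_compact_integrable => //; exact: segment_compact.
Qed.

Lemma truncated_cdf_comp_continuous :
  {within `[a, b], continuous (fun u => psi (F u))}.
Proof.
move=> x; apply: (@continuous_comp (subspace `[a, b]) _ _ F psi).
  exact: cdf_on_continuous_within.
exact: truncated_cdf_integral_continuous.
Qed.

Let linear_continuous (h : R -> R) : {within `[a, b], continuous h} ->
  {within `[a, b], continuous (fun u => (b - u) * h u)}.
Proof.
move=> ch x; apply: (@cvgM _ (subspace `[a, b])); last exact: ch.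
apply: (@cvgB _ _ (subspace `[a, b])); first exact: cvg_cst.
exact: (continuous_subspaceT (fun x => @cvg_id _ (nbhs x))).
Qed.

Let int_linear h : is_density a b h ->
  mu.-integrable `[a, b] (EFin \o (fun u => (b - u) * cdf_on a b h u)).
Proof.
move=> dh; apply/integrable_segment/linear_continuous.
exact: cdf_on_continuous_within.
Qed.

Let int_linear2 h : is_density a b h ->
  (\int[mu]_(u in `[a, b]) (2 * (b - u) * cdf_on a b h u)%:E =
   (2 * \int[mu]_(u in `[a, b]) ((b - u) * cdf_on a b h u))%:E)%E.
Proof.
move=> dh; under eq_integral do rewrite -mulrA.
rewrite -RintegralZl//; last exact: int_linear.
rewrite EFin_Rintegral//.
by apply: eq_integrable (integrableZl _ 2 (int_linear dh)).
Qed.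

Let iterated_min :
  (\int[mu]_(u in `[a, b]) \int[mu]_(v in `[a, b]) (Num.min (F u) (G v))%:E =
   (\int[mu]_(u in `[a, b]) psi (F u))%:E)%E.
Proof.
under eq_integral do rewrite EFin_Rintegral ?integrable_truncated_cdf//.
by rewrite EFin_Rintegral//; exact/integrable_segment/truncated_cdf_comp_continuous.
Qed.

(** Half the cost of the monotone coupling, as [cost_monotone] confirms. *)
Let risk_value := \int[mu]_(u in `[a, b]) ((b - u) * F u) +
  \int[mu]_(u in `[a, b]) ((b - u) * G u) -
  \int[mu]_(u in `[a, b]) psi (F u).

Let cost (p : probability (measurableTypeR R * measurableTypeR R)%type R) :=
  (\int[p]_(z in `[a, b] `*` `[a, b]) (`|z.1 - z.2| ^+ 2)%:E)%E.

Let iterated_joint_cdf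
    (p : probability (measurableTypeR R * measurableTypeR R)%type R) :=
  (\int[mu]_(u in `[a, b]) \int[mu]_(v in `[a, b]) joint_cdf a b p u v)%E.

Let costE p : coupling a b f g p ->
  (cost p + 2%:E * iterated_joint_cdf p =
   (2 * (risk_value + \int[mu]_(u in `[a, b]) psi (F u)))%:E)%E.
Proof.
move=> pfg; rewrite /cost /iterated_joint_cdf (coupling_costE df dg pfg).
rewrite !int_linear2// -EFinD; congr EFin; rewrite /risk_value; ring.
Qed.

(** By [costE] the cost plus twice the joint term is the same for every coupling, so an upper bound
    on [joint_cdf] is a lower bound on the cost. *)
Let cost_lower p : coupling a b f g p -> ((2 * risk_value)%:E <= cost p)%E.
Proof.
move=> pfg; have J_ge0 u v : (0 <= joint_cdf a b p u v)%E by [].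
have I_ge0 : (0 <= iterated_joint_cdf p)%E.
  by apply: integral_ge0 => u _; exact: integral_ge0.
have I_le : (iterated_joint_cdf p <= (\int[mu]_(u in `[a, b]) psi (F u))%:E)%E.
  rewrite -iterated_min; apply: ge0_le_integral => //.
  - by move=> u _; exact: integral_ge0.
  - exact: (joint_cdf_integral2 a b p).1.
  - apply: (@eq_measurable_fun _ _ _ _ _ (EFin \o (fun u => psi (F u)))).
      by move=> u _; rewrite /= EFin_Rintegral// integrable_truncated_cdf.
    apply: (@measurable_int _ _ _ mu).
    exact/integrable_segment/truncated_cdf_comp_continuous.
  move=> u _; apply: ge0_le_integral => //.
  - exact: (joint_cdf_integral a b p u).1.
  - exact: measurable_int (integrable_truncated_cdf ab dg (F u)).
  - by move=> v _; exact: joint_cdf_le.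
(* Lying between 0 and a real number, the joint term is finite, so the identity can be solved for
   the cost. *)
have := costE pfg; move: I_ge0 I_le.
case: (iterated_joint_cdf p) => [r| |]//; rewrite !lee_fin => r0 r1.
case: (cost p) => [c| |]//.
rewrite -EFinM -EFinD => -[cE]; rewrite lee_fin; lra.
Qed.

Let cost_monotone : cost (monotone_coupling ab df dg) = (2 * risk_value)%:E.
Proof.
have := costE (monotone_couplingP ab df dg).
have -> : iterated_joint_cdf (monotone_coupling ab df dg) =
    (\int[mu]_(u in `[a, b]) psi (F u))%:E.
  rewrite -iterated_min; apply: eq_integral => u _; apply: eq_integral => v.
  by rewrite inE/= in_itv/=; exact: joint_cdf_monotone.
rewrite mulrDr EFinD -EFinM => /(congr1 (fun x => x -
  (2 * \int[mu]_(u in `[a, b]) psi (F u))%:E)%E).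
by rewrite addeK// => ->; rewrite -EFinB addrK.
Qed.

Lemma integrable_risk_integrand :
  mu.-integrable `[a, b] (EFin \o (fun u => (b - u) * F u - psi (F u))).
Proof.
apply: integrable_EFinB => //; first exact: int_linear.
exact: integrable_segment truncated_cdf_comp_continuous.
Qed.

(** Here the infimum over couplings disappears. The first integral does not involve [f]; the second
    is taken over the open interval, where 0 < F < 1 and [psi] is differentiable at [F u]. *)
Lemma half_W2_sqr : 2^-1 * W2 a b f g ^+ 2 =
  \int[mu]_(u in `[a, b]) ((b - u) * G u) +
  \int[mu]_(u in `]a, b[) ((b - u) * F u - psi (F u)).
Proof.
have W2E : W2 a b f g = Num.sqrt (2 * risk_value).
  rewrite /W2; congr Num.sqrt.
  suff -> : ereal_inf [set cost p | p in coupling a b f g] = (2 * risk_value)%:E.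
    by [].
  apply/eqP; rewrite eq_le; apply/andP; split.
    rewrite -cost_monotone; apply: ereal_inf_lbound.
    exists (monotone_coupling ab df dg) => //; exact: monotone_couplingP.
  by apply: le_ereal_inf_tmp => _ [p pfg <-]; exact: cost_lower.
(* The radicand is nonnegative because it is the cost of a coupling. *)
rewrite W2E sqr_sqrtr; last first.
  rewrite -lee_fin -cost_monotone; apply: integral_ge0 => z _.
  by rewrite lee_fin exprn_ge0.
rewrite mulrA mulVf ?pnatr_eq0// mul1r /risk_value.
have ipsi := integrable_segment truncated_cdf_comp_continuous.
have i0 := integrable_risk_integrand.
rewrite Rintegral_itv_obnd_cbnd; last first.
  by apply: integrableS i0 => //; exact: subset_itv_oo_cc.
rewrite Rintegral_itv_bndo_bndc; last first.
  by apply: integrableS i0 => //; exact: subset_itv_co_cc.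
rewrite RintegralB//; last exact: int_linear.
by rewrite -addrA addrCA addrA.
Qed.

End W2_formula.

(** * Integrals depending on a parameter *)

(** Transfers dominated convergence, a statement on sequences, to the neighbourhood filter. If the
    limit failed, choosing bad points at distance below 1/(n+1) would produce a contradicting
    sequence inside [N]. *)
Lemma cvg_nbhs_seq (R : realType) (V : normedModType R) (f : V -> R) (t : V)
    (N : set V) (l : R) : nbhs t N ->
  (forall u : nat -> V, (forall n, N (u n)) -> u n @[n --> \oo] --> t ->
     f (u n) @[n --> \oo] --> l) ->
  f s @[s --> t] --> l.
Proof.
move=> Nt seqf; apply/cvgrPdist_lt => e e0; apply: contrapT => nf.
have /choice[u uP] : forall n : nat, exists s,
    [/\ N s, `|t - s| < n.+1%:R^-1 & e <= `|l - f s|].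
  move=> n; apply: contrapT => /forallNP uN; apply: nf.
  have n0 : (0 : R) < n.+1%:R^-1 by rewrite invr_gt0.
  have Bt : \forall s \near t, `|t - s| < n.+1%:R^-1.
    exact: cvgr_dist_lt cvg_id _ n0.
  apply: filterS (filterI Nt Bt) => s [Ns ts].
  by rewrite ltNge; apply/negP => es; apply: (uN s).
have ut : u n @[n --> \oo] --> t.
  apply/cvgrPdist_lt => r r0; near=> n; have [_ + _] := uP n.
  move=> /lt_trans; apply; near: n; exact: near_infty_natSinv_lt (PosNum r0).
have /cvgrPdist_lt/(_ _ e0)[n _ /(_ n (leqnn n))] :=
  seqf u (fun n => let: And3 h _ _ := uP n in h) ut.
by have [_ _] := uP n; rewrite leNgt => /negP.
Unshelve. all: by end_near. Qed.

Section line.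
Context (R : realType) (V : normedModType R) (f : V -> R) (t v : V) (r : R).

Let quotientE :
  (fun h : R => h^-1 *: (((fun r => f (t + r *: v)) \o shift r) (h *: (1 : R)) -
                         f (t + r *: v))) =
  (fun h : R => h^-1 *: ((f \o shift (t + r *: v)) (h *: v) - f (t + r *: v))).
Proof.
apply/funext => h /=; congr (_ *: (f _ - _)).
have -> : h *: (1 : R) = h by rewrite /GRing.scale/= mulr1.
by rewrite scalerDl addrCA.
Qed.

(** Opens the one-variable theorems (mean value, chain rule, differentiation under the integral) to
    directional derivatives in the parameter. *)
Lemma derivable_line :
  derivable (fun r : R => f (t + r *: v)) r (1 : R) = derivable f (t + r *: v) v.
Proof. by rewrite /derivable quotientE. Qed.

Lemma derive_line :
  'D_(1 : R) (fun r : R => f (t + r *: v)) r = 'D_v f (t + r *: v).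
Proof. by rewrite /derive quotientE. Qed.

End line.

Lemma near_line (R : realType) (V : normedModType R) (t v : V) (N : set V) :
  nbhs t N -> \forall r \near (0 : R), N (t + r *: v).
Proof.
move=> Nt; have : (t + r *: v) @[r --> (0 : R)] --> t.
  rewrite -[X in _ --> X]addr0 -[X in _ --> _ + X](scale0r v).
  by apply: cvgD; [exact: cvg_cst|apply: cvgZr_tmp; exact: cvg_id].
exact.
Qed.

(** The bound is asked at every point of [D], not almost everywhere: exceptional points are removed
    from [D] beforehand. *)
Definition dominated_on (R : realType) (T : Type) (D : set R) (N : set T)
    (h : R -> T -> R) : Prop :=
  exists G : R -> R, [/\ forall x, 0 <= G x,
    (@lebesgue_measure R).-integrable D (EFin \o G) &
    forall x s, D x -> N s -> `|h x s| <= G x].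

Section parameter.
Context (R : realType) (V : normedModType R).
Notation mu := (@lebesgue_measure R).
Context (D : set R) (N : set V) (h : R -> V -> R) (t : V).
Hypotheses (mD : measurable (D : set (measurableTypeR R))) (Nt : nbhs t N).

Lemma dominated_integrable s : N s -> measurable_fun D (h ^~ s) ->
  dominated_on D N h -> mu.-integrable D (EFin \o h ^~ s).
Proof.
move=> Ns mh [G [G0 iG hG]].
apply: (@le_integrable _ _ _ mu D mD _ (EFin \o G)) => //; first exact/measurable_EFinP.
by move=> x Dx; rewrite /= !lee_fin (ger0_norm (G0 x)) hG.
Qed.

Lemma dominated_continuous : (forall s, N s -> measurable_fun D (h ^~ s)) ->
  dominated_on D N h ->
  (forall x, D x -> h x s @[s --> t] --> h x t) ->
  \int[mu]_(x in D) h x s @[s --> t] --> \int[mu]_(x in D) h x t.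
Proof.
move=> mh dh ch; have [G [G0 iG hG]] := dh.
apply: (cvg_nbhs_seq Nt) => u Nu ut.
have Nt' : N t by exact: nbhs_singleton.
have it := dominated_integrable Nt' (mh t Nt') dh.
apply: fine_cvg; rewrite fineK; last exact: (integrable_fin_num mD it).
apply: (@dominated_cvg _ _ _ mu D mD (fun n x => (h x (u n))%:E) _ (EFin \o G)).
- by move=> n; apply/measurable_EFinP; exact: mh (Nu n).
- move=> x Dx; apply: cvg_EFin; first exact: nearW.
  exact: (cvg_comp _ _ ut (ch x Dx)).
- by [].
- exact: iG.
- by move=> n x Dx; rewrite lee_fin hG.
Qed.

(** A derivative in the parameter is a pointwise limit of difference quotients, each measurable in
    [x]. *)
Lemma measurable_derive (v : V) : (forall s, N s -> measurable_fun D (h ^~ s)) ->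
  (forall x, D x -> derivable (h x) t v) ->
  measurable_fun D (fun x => 'D_v (h x) t).
Proof.
move=> mh dh.
(* The index shift [m] keeps all points [t + r n *: v] inside [N]. *)
have [m _ mN] : \forall n \near \oo, N (t + n.+1%:R^-1 *: v).
  have nearN := near_line v Nt.
  exact: (@cvg_harmonic R _ nearN).
pose r n : R := (n + m).+1%:R^-1.
have r0 : r n @[n --> \oo] --> (0 : R).
  by rewrite (cvg_shiftn m (fun n => n.+1%:R^-1 : R)); exact: cvg_harmonic.
apply: (@measurable_fun_cvg _ _ _ D
  (fun n x => (r n)^-1 * (h x (t + r n *: v) - h x t))).
- move=> n; apply: measurable_funM => //; apply: measurable_funB.
    by apply: mh; apply: mN; exact: leq_addl.
  by apply: mh; exact: nbhs_singleton Nt.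
- move=> x Dx; pose q (k : R) := k^-1 *: ((h x \o shift t) (k *: v) - h x t).
  have cq : q @ (0 : R)^' --> 'D_v (h x) t by exact: dh.
  have qr : q (r n) @[n --> \oo] --> 'D_v (h x) t.
    move/cvgr_dnbhsP : cq; apply; split => // n.
    by rewrite /r invr_eq0 pnatr_eq0.
  rewrite (_ : (fun _ => _) = (fun n => q (r n)))//.
  by apply/funext => n; rewrite /q /= [t + _]addrC.
Qed.

(** The one-variable theorem on an interval (-e, e) small enough for the line through [t] to stay in
    [N]. *)
Lemma is_derive_under_integral (v : V) :
  (forall s, N s -> mu.-integrable D (EFin \o h ^~ s)) ->
  (forall x s, D x -> N s -> derivable (h x) s v) ->
  dominated_on D N (fun x s => 'D_v (h x) s) ->
  is_derive t v (fun s => \int[mu]_(x in D) h x s)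
    (\int[mu]_(x in D) 'D_v (h x) t).
Proof.
move=> ih dh [G [G0 iG hG]].
have [e /= e0 eN] := near_line v Nt.
have eI r : `]-e, e[ r -> N (t + r *: v).
  by rewrite /= in_itv/= -ltr_norml => re; apply: eN; rewrite /= sub0r normrN.
pose f (r : R) x := h x (t + r *: v).
have := @cvg_differentiation_under_integral R _ _ mu f D mD 0 (- e) e.
have I0 : `]-e, e[ 0 by rewrite /= in_itv/= oppr_lt0 e0.
move=> /(_ I0 (fun r Ir => ih _ (eI r Ir))).
have df r x : `]-e, e[ r -> D x -> derivable (f ^~ x) r 1.
  by move=> Ir Dx; rewrite derivable_line; apply/dh/eI.
move=> /(_ df G G0 iG).
have d1f r x : partial1of2 f r x = 'D_v (h x) (t + r *: v).
  by rewrite partial1of2E derive_line.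
have bf r x : `]-e, e[ r -> D x -> `|partial1of2 f r x| <= G x.
  by move=> Ir Dx; rewrite d1f; apply: hG => //; exact: eI.
move=> /(_ bf).
have -> : \int[mu]_(x in D) partial1of2 f 0 x = \int[mu]_(x in D) 'D_v (h x) t.
  by apply: eq_Rintegral => x _; rewrite d1f scale0r addr0.
set F := fun s => \int[mu]_(x in D) h x s.
rewrite [X in X @ _ --> _](_ : _ =
  (fun k : R => k^-1 *: ((F \o shift t) (k *: v) - F t))); last first.
  apply/funext => k; rewrite /F /f /=; congr (_ *: (_ - _)).
    by rewrite addr0 addrC.
  by rewrite scale0r addr0.
move=> cF; apply: DeriveDef; last exact: cvg_lim cF.
by apply/cvg_ex; eexists; exact: cF.
Qed.

End parameter.

(** Only a derivative in the direction [v] is assumed of [f], so the chain rule for differentiable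
    maps is out of reach; along the line it is the one-variable rule. *)
Lemma is_derive_comp_dir (R : realType) (V : normedModType R) (f : V -> R)
    (phi : R -> R) (t v : V) (l m : R) :
  is_derive t v f l -> is_derive (f t) 1 phi m ->
  is_derive t v (fun s => phi (f s)) (m * l).
Proof.
move=> [df fl] dphi.
have df0 : is_derive (0 : R) 1 (fun r : R => f (t + r *: v)) l.
  by apply: DeriveDef; rewrite ?derivable_line ?derive_line scale0r addr0.
have dphi0 : is_derive (f (t + (0 : R) *: v)) 1 phi m by rewrite scale0r addr0.
have [dc cE] := is_derive1_comp dphi0 df0.
pose g s := phi (f s).
(* Refolds the composite as [g] along the line, the shape that [derivable_line] and [derive_line]
   rewrite. *)
change (derivable (fun r : R => g (t + r *: v)) 0 1) in dc.
change ('D_(1 : R) (fun r : R => g (t + r *: v)) 0 = m * l) in cE.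
move: dc cE; rewrite derivable_line derive_line scale0r addr0 => dg gE.
exact: DeriveDef.
Qed.

Lemma cvg_near_eq (R : realType) (V : normedModType R) (f g : V -> R) (t : V)
    (l : R) : (\forall s \near t, f s = g s) ->
  f s @[s --> t] --> l -> g s @[s --> t] --> l.
Proof. by move=> fg; apply: cvg_trans; exact: near_eq_cvg. Qed.

Lemma cvg0_dominated (R : realType) (V : normedModType R) (f g : V -> R) (t : V) :
  (\forall s \near t, `|f s| <= g s) ->
  g s @[s --> t] --> (0 : R) -> f s @[s --> t] --> (0 : R).
Proof.
move=> fg g0; apply/cvgr0Pnorm_le => r r0; near=> s.
have fgs : `|f s| <= g s by near: s.
rewrite (le_trans fgs)// (le_trans (ler_norm _))//; near: s.
exact: cvgr0_norm_le.
Unshelve. all: by end_near. Qed.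

Lemma cvg_matrix (R : realType) (T : Type) (F : set_system T) (m n : nat)
    (A : T -> 'M[R]_(m, n)) (L : 'M[R]_(m, n)) : Filter F ->
  (forall i j, A t i j @[t --> F] --> L i j) -> A t @[t --> F] --> L.
Proof.
move=> FF AL; apply/cvg_ballP => r r0.
have : \forall t \near F, forall i j, ball (L i j) r (A t i j).
  by apply: filter_forall => i; apply: filter_forall => j;
    exact: (cvg_ball (AL i j)).
by apply: filterS => t Bt; split.
Qed.

(** An integrable supremum is finite almost everywhere, and where it is finite its real part bounds
    the family. The absolute value makes the bound nonnegative everywhere. *)
Lemma sup_integrable_bound (R : realType) (d : nat) (a b : R)
    (N : set 'rV[R]_d) (h : R -> 'rV[R]_d -> R) :
  sup_integrable a b N h ->
  exists G : R -> R, [/\ forall x, 0 <= G x,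
    (@lebesgue_measure R).-integrable `[a, b] (EFin \o G) &
    {ae @lebesgue_measure R, forall x, a <= x <= b ->
       forall s, N s -> `|h x s| <= G x}].
Proof.
rewrite /sup_integrable; set S := fun x => ereal_sup _ => iS.
have mI : measurable (`[a, b] : set (measurableTypeR R)) by exact: measurable_itv.
exists (fun x => `|fine (S x)|); split => //.
  apply: (@le_integrable _ _ _ (@lebesgue_measure R) _ mI _ S _ _ iS).
    apply/measurable_EFinP; apply: measurableT_comp => //.
    by apply: measurableT_comp => //; case/integrableP: iS.
  by move=> x _ /=; rewrite normr_id; case: (S x) => //= *; rewrite leey.
have := integrable_ae mI iS; apply: filterS => x.
rewrite /= in_itv/= => + xab s Ns => /(_ xab) Sfin.
apply: le_trans (ler_norm _); rewrite -lee_fin fineK//.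
by apply: ereal_sup_ubound; exists s.
Qed.

Lemma derive_sum_partial (R : realType) (d : nat) (f : 'rV[R]_d -> R)
    (t v : 'rV[R]_d) : differentiable f t ->
  'D_v f t = \sum_i v 0 i * partial i f t.
Proof.
move=> df; rewrite deriveE// {1}(row_sum_delta v) linear_sum.
by apply: eq_bigr => i _; rewrite linearZ /partial deriveE.
Qed.

Lemma mvt_segment (R : realType) (d : nat) (f : 'rV[R]_d -> R)
    (t v : 'rV[R]_d) :
  (forall r : R, 0 <= r <= 1 -> differentiable f (t + r *: v)) ->
  exists2 c : R, 0 < c < 1 &
    f (t + v) - f t = \sum_i v 0 i * partial i f (t + c *: v).
Proof.
move=> df; pose g (r : R) := f (t + r *: v).
have dg (r : R) : 0 <= r <= 1 -> derivable g r 1.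
  by move=> r01; rewrite derivable_line; apply/diff_derivable/df.
have [|||c c01 gE] := @MVT R g (fun r => 'D_(1 : R) g r) 0 1.
- exact: ltr01.
- move=> r; rewrite in_itv/= => /andP[r0 r1]; apply: DeriveDef => //.
  by apply: dg; rewrite !ltW.
- apply: derivable_within_continuous => r; rewrite in_itv/=; exact: dg.
exists c; first by rewrite in_itv/= in c01.
move: gE; rewrite /g scale1r scale0r addr0 subr0 mulr1 => ->.
rewrite derive_line derive_sum_partial//; apply: df.
by move: c01; rewrite in_itv/= => /andP[/ltW-> /ltW->].
Qed.

Lemma density_lower_bound (R : realType) (a b : R) (f : R -> R) :
  a < b -> is_density a b f ->
  exists2 m : R, 0 < m & forall x, a <= x <= b -> m <= f x.
Proof.
move=> ab df; have [c cab fc] := EVT_min (ltW ab) (density_continuous_within df).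
have [_ fp _] := df; exists (f c); first by apply: fp; rewrite in_itv/= in cab.
by move=> x xab; apply: fc; rewrite in_itv.
Qed.

Lemma smooth_continuous (R : realType) (f : R -> R) : smooth f -> continuous f.
Proof.
by move=> sf x; apply/differentiable_continuous/derivable1_diffP; exact: (sf 0%N).
Qed.

Lemma smooth_derive (R : realType) (f : R -> R) : smooth f -> smooth f^`().
Proof. by move=> sf n x; rewrite -derive1Sn; exact: (sf n.+1). Qed.

Lemma model_density (R : realType) (d : nat) (a b : R) (Theta : set 'rV[R]_d)
    (rho : R -> 'rV[R]_d -> R) (t : 'rV[R]_d) :
  statistical_model a b Theta rho -> Theta t -> is_density a b (rho ^~ t).
Proof.
move=> [_ pos mass sx _] Tt; split.
- have [g sg rg] := sx t Tt; exists g; first exact: smooth_continuous.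
  by move=> x; rewrite in_itv/=; exact: rg.
- by move=> x; exact: pos.
- exact: mass.
Qed.

Lemma ae_null_set (R : realType) (P : R -> Prop) (a b : R) :
  {ae @lebesgue_measure R, forall x, P x} ->
  exists Z : set R, [/\ measurable (Z : set (measurableTypeR R)),
    @lebesgue_measure R Z = 0%E, Z a, Z b & forall x, ~ Z x -> P x].
Proof.
move=> [Z [mZ Z0 PZ]]; exists (Z `|` [set a] `|` [set b]).
have m1 c : measurable ([set c] : set (measurableTypeR R)) by exact: measurable_set1.
split.
- by apply: measurableU => //; exact: measurableU.
- rewrite measureU0//; [|exact: measurableU|exact: lebesgue_measure_set1].
  by rewrite measureU0//; exact: lebesgue_measure_set1.
- by left; right.
- by right.
- by move=> x; apply: contra_notP => nP; left; left; exact: PZ.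
Qed.

(** * The risk of a statistical model *)

Section model.
Context (R : realType) (d : nat) (a b : R) (Theta : set 'rV[R]_d)
  (rho : R -> 'rV[R]_d -> R) (ts : 'rV[R]_d) (delta : R).
Notation mu := (@lebesgue_measure R).
Notation e i := (delta_mx 0 i : 'rV[R]_d).
Notation F := (model_cdf a b rho).
Notation U := (ball ts delta : set 'rV[R]_d).
Hypotheses (ab : a < b) (model : statistical_model a b Theta rho)
  (delta0 : 0 < delta) (UT : U `<=` Theta).
(* Z is a null set off which the suprema of hypothesis (2) are finite; the
   endpoints are thrown in so that the quantile is differentiable off Z. *)
Context (Z : set R) (G1 : 'I_d -> R -> R).
Hypotheses (mZ : measurable (Z : set (measurableTypeR R))) (Z0 : mu Z = 0%E)
  (Za : Z a) (Zb : Z b) (G1_ge0 : forall i x, 0 <= G1 i x)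
  (iG1 : forall i, mu.-integrable `[a, b] (EFin \o G1 i))
  (rhoG1 : forall x, a <= x <= b -> ~ Z x -> forall i (s : 'rV[R]_d), U s ->
     `|partial i (rho x) s| <= G1 i x).

Notation B := (`[a, b] `\` Z).
Notation Bto x := ((`[a, b] `&` `]-oo, x]) `\` Z).

Let mI : measurable (`[a, b] : set (measurableTypeR R)).
Proof. exact: measurable_itv. Qed.

Let mIx x : measurable (`[a, b] `&` `]-oo, x] : set (measurableTypeR R)).
Proof. exact: measurableI. Qed.

Lemma measurable_offnull : measurable (B : set (measurableTypeR R)).
Proof. exact: measurableD. Qed.

Lemma measurable_offnull_to x : measurable (Bto x : set (measurableTypeR R)).
Proof. exact: measurableD. Qed.

Lemma offnull_oo x : B x -> a < x < b.
Proof.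
move=> [/=]; rewrite in_itv/= => /andP[ax xb] nZ.
rewrite !lt_neqAle ax xb !andbT; apply/andP; split.
  by apply/eqP => xa; apply: nZ; rewrite -xa.
by apply/eqP => xa; apply: nZ; rewrite xa.
Qed.

Lemma offnull_to_cc x y : Bto x y -> a <= y <= b.
Proof. by move=> [[/=]]; rewrite in_itv. Qed.

Lemma nbhs_param_ball s : U s -> nbhs s U.
Proof. by move=> Us; apply: open_nbhs_nbhs; split => //; exact: ball_open. Qed.

Lemma param_ball_center : U ts. Proof. exact: ballxx. Qed.

Let dens s : Theta s -> is_density a b (rho ^~ s).
Proof. exact: model_density. Qed.

(** * The distribution function as a function of the parameter *)

Lemma integrable_model s x : Theta s -> mu.-integrable (Bto x) (EFin \o rho ^~ s).
Proof.
move=> Ts; apply: (integrableS mI) (density_integrable (dens Ts)).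
  exact: measurable_offnull_to.
by move=> y [[]].
Qed.

(** Deleting [Z] leaves the integral unchanged, and on what is left the bound [G1] holds at every
    point. *)
Lemma model_cdfE x s : Theta s -> F x s = \int[mu]_(y in Bto x) rho y s.
Proof.
move=> Ts; rewrite /model_cdf (Rintegral_setD_null (mIx x) mZ Z0)//.
apply: (integrableS mI (mIx x)) (density_integrable (dens Ts)).
exact: subIsetl.
Qed.

Lemma model_smooth_at x s l : a <= x <= b -> Theta s ->
  differentiable (foldr (@partial R d) (rho x) l) s.
Proof. by move=> xab Ts; have [_ _ _ _ h] := model; exact: h. Qed.

Lemma dominated_partial_model x i :
  dominated_on (Bto x) U (fun y s => partial i (rho y) s).
Proof.
exists (G1 i); split => //.
  apply: (integrableS mI) (iG1 i); first exact: measurable_offnull_to.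
  by move=> y [[]].
by move=> y s By Us; apply: rhoG1 => //; [exact: offnull_to_cc By|case: By].
Qed.

Lemma derivable_model y s i : a <= y <= b -> Theta s -> derivable (rho y) s (e i).
Proof.
by move=> yab Ts; apply: diff_derivable; exact: (@model_smooth_at y s [::]).
Qed.

Lemma is_derive_model_cdf x s i : U s ->
  is_derive s (e i) (F x) (\int[mu]_(y in Bto x) partial i (rho y) s).
Proof.
move=> Us; apply: (@near_eq_is_derive _ _ _ (fun s => \int[mu]_(y in Bto x) rho y s)).
  by apply: filterS (nbhs_param_ball Us) => t /UT Tt; rewrite model_cdfE.
apply: (is_derive_under_integral (measurable_offnull_to x) (nbhs_param_ball Us)).
- by move=> t /UT; exact: integrable_model.
- by move=> y t By /UT Tt; apply: derivable_model => //; exact: offnull_to_cc By.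
- exact: dominated_partial_model.
Qed.

Lemma partial_model_cdfE x s i : U s ->
  partial i (F x) s = \int[mu]_(y in Bto x) partial i (rho y) s.
Proof. by move=> Us; case: (is_derive_model_cdf x i Us). Qed.

Lemma measurable_partial_model x i s : U s ->
  measurable_fun (Bto x) (fun y => partial i (rho y) s).
Proof.
move=> Us; apply: (measurable_derive (nbhs_param_ball Us)).
  move=> t /UT Tt; have /integrableP[+ _] := integrable_model x Tt.
  by move/measurable_EFinP.
by move=> y By; apply: derivable_model; [exact: offnull_to_cc By|exact: UT].
Qed.

Definition score_bound i : R := \int[mu]_(y in `[a, b]) G1 i y.

Lemma score_bound_ge0 i : 0 <= score_bound i.
Proof. exact: Rintegral_ge0. Qed.

(** The derivative is an integral of d_i rho over part of [a, b], and [G1] bounds the integrand.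
    Uniformity in [x] and [s] lets constants dominate products of such derivatives. *)
Lemma partial_model_cdf_le x s i : U s -> `|partial i (F x) s| <= score_bound i.
Proof.
move=> Us; rewrite partial_model_cdfE//.
have mBx := measurable_offnull_to x.
have idr : mu.-integrable (Bto x) (EFin \o (fun y => partial i (rho y) s)).
  apply: (dominated_integrable mBx Us) (dominated_partial_model x i).
  exact: measurable_partial_model.
apply: le_trans (le_normr_Rintegral mBx idr) _.
have iG1x : mu.-integrable (Bto x) (EFin \o G1 i).
  by apply: (integrableS mI mBx) (iG1 i) => y [[]].
apply: (@le_trans _ _ (\int[mu]_(y in Bto x) G1 i y)).
  apply: le_Rintegral => //; first exact: integrable_norm.
  by move=> y By; apply: rhoG1 => //; [exact: offnull_to_cc By|case: By].
rewrite -lee_fin -EFin_Rintegral// -EFin_Rintegral//.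
apply: ge0_subset_integral => //.
- by case/integrableP: (iG1 i).
- by move=> y _; rewrite lee_fin.
- by move=> y [[]].
Qed.

Lemma partial_model_cdf_continuous x s i : U s ->
  partial i (F x) t @[t --> s] --> partial i (F x) s.
Proof.
move=> Us; rewrite partial_model_cdfE//.
have cint := @dominated_continuous R 'rV[R]_d (Bto x) U
  (fun y s => partial i (rho y) s)
  s (measurable_offnull_to x) (nbhs_param_ball Us)
  (fun t Ut => @measurable_partial_model x i t Ut) (dominated_partial_model x i).
apply: cvg_near_eq (cint _).
  by apply: filterS (nbhs_param_ball Us) => t Ut; rewrite partial_model_cdfE.
move=> y By; apply: differentiable_continuous.
by apply: (@model_smooth_at y s [:: i]); [exact: offnull_to_cc By|exact: UT].
Qed.

(** Existence of partial derivatives would not give continuity. Instead rho, which is differentiable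
    in the parameter, is dominated near [ts] and the limit is taken under the integral. *)
Lemma model_cdf_continuous x : F x t @[t --> ts] --> F x ts.
Proof.
have Uts := param_ball_center.
rewrite (model_cdfE x (UT Uts)).
have mr s : U s -> measurable_fun (Bto x) (rho ^~ s).
  move=> /UT Ts; have /integrableP[+ _] := integrable_model x Ts.
  by move/measurable_EFinP.
have domr : dominated_on (Bto x) U rho.
  (* Mean value bound along the segment from [ts] to [s]: each coordinate of [s - ts] is below
     [delta] in absolute value, balls being those of the sup norm. *)
  exists (fun y => `|rho y ts| + \sum_i delta * G1 i y); split.
  - move=> y; apply: addr_ge0 => //; apply: sumr_ge0 => i _.
    by apply: mulr_ge0 => //; exact: ltW.
  - have iS : mu.-integrable (Bto x) (fun y => (\sum_i (delta%:E * (G1 i y)%:E))%E).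
      apply: integrable_sum; first exact: measurable_offnull_to.
      move=> i _; apply: integrableZl; first exact: measurable_offnull_to.
      by apply: (integrableS mI) (iG1 i);
        [exact: measurable_offnull_to|move=> y [[]]].
    have iN := integrable_norm (integrable_model x (UT Uts)).
    apply: eq_integrable (integrableD (measurable_offnull_to x) iN iS).
      exact: measurable_offnull_to.
    by move=> y _; rewrite /= EFinD -sumEFin.
  - move=> y s By Us; have yab := offnull_to_cc By.
    have Uline (r : R) : 0 <= r <= 1 -> U (ts + r *: (s - ts)).
      move=> /andP[r0 r1]; move: Us; rewrite -!ball_normE/= => Us.
      rewrite opprD addNKr normrN normrZ ger0_norm//.
      by rewrite (le_lt_trans _ Us)// distrC ler_piMl.
    have [|c c01 rE] := @mvt_segment R d (rho y) ts (s - ts).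
      by move=> r r01; apply: (@model_smooth_at y _ [::]) => //; exact/UT/Uline.
    have -> : rho y s = rho y ts + (rho y s - rho y ts) by rewrite addrC subrK.
    move: rE; rewrite [ts + (s - ts)]addrC subrK => ->.
    apply: le_trans (ler_normD _ _) _; rewrite lerD2l.
    apply: le_trans (ler_norm_sum _ _ _) _; apply: ler_sum => i _.
    rewrite normrM; apply: ler_pM => //.
      have : ball (ts 0 i) delta (s 0 i) by case: Us => _; exact.
      by rewrite -ball_normE/= distrC !mxE => /ltW.
    apply: rhoG1 => //; first by case: By.
    by apply: Uline; case/andP: c01 => /ltW-> /ltW->.
have := dominated_continuous (measurable_offnull_to x) (nbhs_param_ball Uts) mr domr.
move=> cint; apply: cvg_near_eq (cint _).
  by apply: filterS (nbhs_param_ball Uts) => t /UT Tt; rewrite model_cdfE.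
move=> y By; apply: differentiable_continuous.
by apply: (@model_smooth_at y ts [::]); [exact: offnull_to_cc By|exact: UT].
Qed.

Let dg : is_density a b (rho ^~ ts) := dens (UT param_ball_center).
Notation Q := (quantile ab dg).
Notation psi := (truncated_cdf_integral a b (rho ^~ ts)).

Hypothesis hF : forall x t, a <= x <= b -> Theta t -> has_hessian (F x) t.
Context (G2 : 'I_d -> 'I_d -> R -> R).
Hypotheses (G2_ge0 : forall i j x, 0 <= G2 i j x)
  (iG2 : forall i j, mu.-integrable `[a, b] (EFin \o G2 i j))
  (FG2 : forall x, a <= x <= b -> ~ Z x -> forall i j s, U s ->
     `|partial i (partial j (F x)) s| <= G2 i j x).

Let oo_cc x : a < x < b -> a <= x <= b.
Proof. by case/andP => /ltW-> /ltW->. Qed.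

(** * The transport map as a function of the parameter *)

Lemma model_cdf_oo x s : a < x < b -> Theta s -> 0 < F x s < 1.
Proof.
move=> /andP[ax xb] Ts; apply/andP; split.
  by rewrite -(cdf_on_le (rho ^~ s) ab (lexx a)) (cdf_on_lt ab (dens Ts))// ltW.
by rewrite -(cdf_on_ge (dens Ts) (lexx b)) (cdf_on_lt ab (dens Ts))// ltW.
Qed.

Lemma quantile_model_itv x s : Theta s -> a <= Q (F x s) <= b.
Proof. by move=> Ts; exact: (monotone_map_itv ab (dens Ts) dg). Qed.

Lemma quantile_model_truth x : a <= x <= b -> Q (F x ts) = x.
Proof. by move=> xab; exact: (cdf_onK ab dg). Qed.

Lemma is_derive_model_cdf_partial x s i : U s -> is_derive s (e i) (F x) (partial i (F x) s).
Proof. by move=> Us; apply: DeriveDef => //; case: (is_derive_model_cdf x i Us). Qed.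

Lemma is_derive_quantile_model x s i : a < x < b -> U s ->
  is_derive s (e i) (fun t => Q (F x t))
    ((rho (Q (F x s)) ts)^-1 * partial i (F x) s).
Proof.
move=> xab Us; apply: is_derive_comp_dir; first exact: is_derive_model_cdf_partial.
exact: (is_derive_quantile ab dg (model_cdf_oo xab (UT Us))).
Qed.

(** The transport map tends to the identity: F(x, s) tends to F(x, ts), and [Q] is continuous at
    that interior level. *)
Lemma quantile_model_continuous x : a < x < b -> Q (F x s) @[s --> ts] --> x.
Proof.
move=> xab; rewrite -[X in _ --> X](quantile_model_truth (oo_cc xab)).
have cQ : {for F x ts, continuous Q}.
  apply/differentiable_continuous/derivable1_diffP.
  by case: (is_derive_quantile ab dg (model_cdf_oo xab (UT param_ball_center))).
exact: (cvg_comp _ _ (@model_cdf_continuous x) cQ).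
Qed.

Lemma measurable_quantile_model s : Theta s ->
  measurable_fun setT (fun x => Q (F x s)).
Proof. by move=> Ts; exact: (measurable_monotone_map ab (dens Ts) dg). Qed.

(** Each F(., t) is monotone, hence measurable, and the parameter derivative inherits this through
    difference quotients. *)
Lemma measurable_partial_model_cdf j s : U s ->
  measurable_fun `[a, b] (fun x => partial j (F x) s).
Proof.
move=> Us; apply: (measurable_derive (nbhs_param_ball Us)).
  move=> t /UT Tt; apply: nondecreasing_measurable => // x y xy.
  exact: (cdf_on_nd ab (dens Tt)).
by move=> x xab; case: (is_derive_model_cdf x j Us).
Qed.

(** * First and second derivatives of the risk *)

Definition risk_slope j x s : R := (Q (F x s) - x) * partial j (F x) s.

Lemma quantile_model_dist x s : a <= x <= b -> U s -> `|Q (F x s) - x| <= b - a.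
Proof.
move=> xab /UT Ts; have := quantile_model_itv x Ts.
by rewrite ler_norml; move: xab; lra.
Qed.

Lemma dominated_risk_slope (D : set R) j :
  measurable (D : set (measurableTypeR R)) -> D `<=` `[a, b] ->
  dominated_on D U (risk_slope j).
Proof.
move=> mD DI; exists (cst ((b - a) * score_bound j)); split.
- by move=> x; rewrite /= mulr_ge0 ?score_bound_ge0// subr_ge0 ltW.
- apply: (integrableS mI mD DI); apply: integrable_segment.
  by move=> x; exact: cvg_cst.
- move=> x s /DI; rewrite /= in_itv/= => xab Us; rewrite normrM.
  by apply: ler_pM => //; [exact: quantile_model_dist|exact: partial_model_cdf_le].
Qed.

Lemma measurable_risk_slope (D : set R) j s :
  measurable (D : set (measurableTypeR R)) -> D `<=` `[a, b] -> U s ->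
  measurable_fun D (risk_slope j ^~ s).
Proof.
move=> mD DI Us; apply: (measurable_funS mI DI).
apply: measurable_funM; last exact: measurable_partial_model_cdf.
apply: measurable_funB => //; apply: measurable_funTS.
exact: measurable_quantile_model (UT Us).
Qed.

Lemma integrable_risk_slope (D : set R) j s :
  measurable (D : set (measurableTypeR R)) -> D `<=` `[a, b] -> U s ->
  mu.-integrable D (EFin \o risk_slope j ^~ s).
Proof.
move=> mD DI Us; apply: (dominated_integrable mD Us).
  exact: measurable_risk_slope.
exact: dominated_risk_slope.
Qed.

Let moo : measurable (`]a, b[ : set (measurableTypeR R)).
Proof. exact: measurable_itv. Qed.

Let soo : `]a, b[ `<=` `[a, b]. Proof. exact: subset_itv_oo_cc. Qed.

Lemma is_derive_risk j s : U s ->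
  is_derive s (e j) (risk a b rho ts) (\int[mu]_(x in `]a, b[) risk_slope j x s).
Proof.
move=> Us.
(* By [half_W2_sqr] the risk is [c] plus the integral of [k x (F x t)], and the derivative of [k x]
   at y is (b - x) - (b - Q y) = Q y - x. *)
pose k x y := (b - x) * y - psi y.
pose c := \int[mu]_(u in `[a, b]) ((b - u) * F u ts).
apply: (@near_eq_is_derive _ _ _
  (fun t => c + \int[mu]_(x in `]a, b[) k x (F x t))).
  apply: filterS (nbhs_param_ball Us) => t /UT Tt.
  by rewrite /risk (half_W2_sqr ab (dens Tt) dg).
have dk x t : a < x < b -> U t ->
    is_derive t (e j) (fun t => k x (F x t)) (risk_slope j x t).
  move=> xab Ut; apply: is_derive_comp_dir; first exact: is_derive_model_cdf_partial.
  have dpsi := is_derive_truncated_cdf_integral ab dg (model_cdf_oo xab (UT Ut)).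
  by apply: is_derive_eq; rewrite /GRing.scale/=; ring.
have -> : \int[mu]_(x in `]a, b[) risk_slope j x s =
    0 + \int[mu]_(x in `]a, b[) 'D_(e j) (fun t => k x (F x t)) s.
  rewrite add0r; apply: eq_Rintegral => x; rewrite inE/= in_itv/= => xab.
  by case: (dk x s xab Us).
apply: is_deriveD; apply: (is_derive_under_integral moo (nbhs_param_ball Us)).
- move=> t /UT Tt; apply: (integrableS mI moo soo).
  exact: (integrable_risk_integrand ab (dens Tt) dg).
- by move=> x t; rewrite /= in_itv/= => xab Ut; case: (dk x t xab Ut).
have [G [G0 iG hG]] := dominated_risk_slope j moo soo.
exists G; split => // x t xab Ut; rewrite (_ : 'D_ _ _ _ = risk_slope j x t).
  exact: hG.
by move: xab; rewrite /= in_itv/= => xab; case: (dk x t xab Ut).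
Qed.

Lemma offnull_sub : B `<=` `[a, b]. Proof. by move=> x []. Qed.

(** The domain passes from the open interval to [a, b] without [Z], where the next differentiation
    has its dominating function. *)
Lemma partial_riskE j s : U s ->
  partial j (risk a b rho ts) s = \int[mu]_(x in B) risk_slope j x s.
Proof.
move=> Us; have -> : B = `]a, b[ `\` Z.
  apply/seteqP; split => [x Bx|x [/soo xI nZ]//].
  by split; [rewrite /= in_itv/= offnull_oo|case: Bx].
rewrite -Rintegral_setD_null//; last exact: integrable_risk_slope.
by case: (is_derive_risk j Us).
Qed.

Definition risk_curvature i j x s : R :=
  (rho (Q (F x s)) ts)^-1 * (partial i (F x) s * partial j (F x) s) +
  (Q (F x s) - x) * partial i (partial j (F x)) s.

Lemma is_derive_risk_slope i j x s : B x -> U s ->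
  is_derive s (e i) (risk_slope j x) (risk_curvature i j x s).
Proof.
move=> Bx Us; have xab := offnull_oo Bx.
have d1 := is_derive_quantile_model i xab Us.
have d2 : is_derive s (e i) (partial j (F x)) (partial i (partial j (F x)) s).
  by apply: DeriveDef => //; case: (hF (oo_cc xab) (UT Us) i j).
have := is_deriveM (is_deriveB d1 (is_derive_cst x s (e i))) d2.
rewrite (_ : _ * _ = risk_slope j x)//.
have alg (A r p1 p2 q : R) :
    A *: q + p2 *: (r * p1 - 0) = r * (p1 * p2) + A * q.
  by rewrite /GRing.scale/=; ring.
by move=> dM; apply: (is_derive_eq dM); exact: alg.
Qed.

(** The reciprocal density is at most 1/m, the first partials at most [score_bound], the
    displacement at most b - a, and [G2] takes the second partials. *)
Lemma dominated_risk_curvature i j : dominated_on B U (risk_curvature i j).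
Proof.
have [m m0 mrho] := density_lower_bound ab dg.
exists (fun x => m^-1 * (score_bound i * score_bound j) + (b - a) * G2 i j x).
have ba : 0 <= b - a by rewrite subr_ge0 ltW.
split.
- move=> x; rewrite addr_ge0// mulr_ge0 ?invr_ge0 ?(ltW m0)//.
  by rewrite mulr_ge0 ?score_bound_ge0.
- apply: (integrableS mI measurable_offnull offnull_sub).
  have iC : mu.-integrable `[a, b]
      (EFin \o cst (m^-1 * (score_bound i * score_bound j))).
    by apply: integrable_segment => x; exact: cvg_cst.
  exact: eq_integrable (integrableD mI iC (integrableZl mI (b - a) (iG2 i j))).
move=> x s Bx Us; have xab := oo_cc (offnull_oo Bx).
apply: le_trans (ler_normD _ _) _; apply: lerD; rewrite normrM; last first.
  by apply: ler_pM => //; [exact: quantile_model_dist|apply: FG2 => //; case: Bx].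
have Qab := quantile_model_itv x (UT Us).
apply: ler_pM => //.
  rewrite normrV ?unitfE; last first.
    by rewrite gt_eqF// (lt_le_trans m0)// mrho.
  rewrite lef_pV2 ?posrE// ?(le_trans _ (ler_norm _)) ?mrho//.
  by rewrite (lt_le_trans m0)// (le_trans (mrho _ Qab))// ler_norm.
by rewrite normrM ler_pM// partial_model_cdf_le.
Qed.

Lemma is_derive_partial_risk i j s : U s ->
  is_derive s (e i) (partial j (risk a b rho ts))
    (\int[mu]_(x in B) risk_curvature i j x s).
Proof.
move=> Us; apply: (@near_eq_is_derive _ _ _
  (fun t => \int[mu]_(x in B) risk_slope j x t)).
  by apply: filterS (nbhs_param_ball Us) => t Ut; rewrite partial_riskE.
have -> : \int[mu]_(x in B) risk_curvature i j x s =
    \int[mu]_(x in B) 'D_(e i) (risk_slope j x) s.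
  apply: eq_Rintegral => x; rewrite inE => Bx.
  by case: (is_derive_risk_slope i j Bx Us).
apply: (is_derive_under_integral measurable_offnull (nbhs_param_ball Us)).
- move=> t Ut; exact: (integrable_risk_slope j measurable_offnull offnull_sub).
- by move=> x t Bx Ut; case: (is_derive_risk_slope i j Bx Ut).
have [G [G0 iG hG]] := dominated_risk_curvature i j.
exists G; split => // x t Bx Ut; rewrite (_ : 'D_ _ _ _ = risk_curvature i j x t).
  exact: hG.
by case: (is_derive_risk_slope i j Bx Ut).
Qed.

Lemma risk_curvature_truth i j x : B x -> risk_curvature i j x ts =
  (rho x ts)^-1 * (partial i (F x) ts * partial j (F x) ts).
Proof.
move=> /offnull_oo/oo_cc xab.
by rewrite /risk_curvature quantile_model_truth// subrr mul0r addr0.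
Qed.

(** No continuity of the second partials of [F x] is used: bounded by [G2], they are multiplied by a
    displacement that tends to 0. The other term is continuous factor by factor. *)
Lemma risk_curvature_continuous i j x : B x ->
  risk_curvature i j x s @[s --> ts] --> risk_curvature i j x ts.
Proof.
move=> Bx; have xab := offnull_oo Bx; have Uts := param_ball_center.
have Qx := quantile_model_continuous xab.
have rho0 : 0 < rho x ts by have [_ + _] := dg; apply; exact: oo_cc.
have c1 : (rho (Q (F x s)) ts)^-1 * (partial i (F x) s * partial j (F x) s)
    @[s --> ts] --> (rho x ts)^-1 * (partial i (F x) ts * partial j (F x) ts).
  have cp k : partial k (F x) s @[s --> ts] --> partial k (F x) ts.
    exact: partial_model_cdf_continuous Uts.
  have cr : rho (Q (F x s)) ts @[s --> ts] --> rho x ts.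
    exact: (cvg_comp _ _ Qx (density_continuous dg xab)).
  exact: (cvgM (cvgV (lt0r_neq0 rho0) cr) (cvgM (cp i) (cp j))).
have cQ : `|Q (F x s) - x| * G2 i j x @[s --> ts] --> (0 : R).
  rewrite -[X in _ --> X](mul0r (G2 i j x)) -[X in X * _](normr0 R).
  rewrite -[X in `|X| * _](subrr x).
  exact: (cvgM (cvg_norm (cvgB Qx (cvg_cst x))) (cvg_cst _)).
have c2 : (Q (F x s) - x) * partial i (partial j (F x)) s @[s --> ts] --> (0 : R).
  apply: cvg0_dominated cQ; apply: filterS (nbhs_param_ball Uts) => s Us.
  rewrite normrM ler_wpM2l//.
  by apply: FG2 => //; [exact: oo_cc|case: Bx].
by rewrite risk_curvature_truth// -[X in _ --> X]addr0; exact: (cvgD c1 c2).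
Qed.

Lemma integral_risk_curvature_cvg i j :
  \int[mu]_(x in B) risk_curvature i j x s @[s --> ts] -->
  \int[mu]_(x in B) ((rho x ts)^-1 * (partial i (F x) ts * partial j (F x) ts)).
Proof.
have -> : \int[mu]_(x in B)
    ((rho x ts)^-1 * (partial i (F x) ts * partial j (F x) ts)) =
    \int[mu]_(x in B) risk_curvature i j x ts.
  by apply: eq_Rintegral => x; rewrite inE => Bx; rewrite risk_curvature_truth.
apply: (dominated_continuous measurable_offnull (nbhs_param_ball param_ball_center)).
(* Measurability of the second partials is not assumed; the curvature is measurable as a derivative
   of the measurable slope. *)
- move=> s Us; apply: (@eq_measurable_fun _ _ _ _ _
    (fun x => 'D_(e i) (risk_slope j x) s)).
    by move=> x; rewrite inE => Bx; case: (is_derive_risk_slope i j Bx Us).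
  apply: (measurable_derive (nbhs_param_ball Us)).
    by move=> t Ut; apply: measurable_risk_slope offnull_sub Ut; exact: measurable_offnull.
  by move=> x Bx; case: (is_derive_risk_slope i j Bx Us).
- exact: dominated_risk_curvature.
- by move=> x Bx; exact: risk_curvature_continuous.
Qed.

(** * The information matrix and the Neumann problem *)

Notation rhos x := (rho x ts).
Notation dF i x := (partial i (F x) ts).

(** Dominated by a constant. This allows passing between [a, b], where the matrix is defined, and
    the domain without [Z], where limits are taken. *)
Lemma integrable_information i j : mu.-integrable `[a, b]
  (EFin \o (fun x => (rhos x)^-1 * (dF i x * dF j x))).
Proof.
have Uts := param_ball_center; have [m m0 mrho] := density_lower_bound ab dg.
have ci : {within `[a, b], continuous (fun x => (rhos x)^-1)}.
  apply/subspace_continuousP => x xI; apply: cvgV.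
    move: xI; rewrite /= in_itv/= => xab.
    by rewrite gt_eqF// (lt_le_trans m0)// mrho.
  by move/subspace_continuousP : (density_continuous_within dg); exact.
have mi : measurable_fun `[a, b] (fun x => (rhos x)^-1).
  exact: subspace_continuous_measurable_fun.
apply: (@le_integrable _ _ _ mu _ mI _
  (EFin \o cst (m^-1 * (score_bound i * score_bound j)))).
- apply/measurable_EFinP; apply: measurable_funM => //.
  by apply: measurable_funM; exact: measurable_partial_model_cdf.
- move=> x; rewrite /= in_itv/= lee_fin => xab; rewrite !normrM.
  have rx : 0 < rhos x by rewrite (lt_le_trans m0)// mrho.
  apply: ler_pM; rewrite ?mulr_ge0//.
    by rewrite !normfV (gtr0_norm rx) (gtr0_norm m0) lef_pV2 ?posrE// mrho.
  by apply: ler_pM => //; rewrite (le_trans (partial_model_cdf_le _ _ Uts))// ler_norm.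
- by apply: integrable_segment => x; exact: cvg_cst.
Qed.

(** The Neumann equation integrated from [a], where the flux vanishes; integrating d_i rho from [a]
    to [x] gives d_i F. *)
Lemma neumann_flux (xi : 'cV[R]_d) (Phi : R -> R) x :
  neumann_solution a b rho ts xi Phi -> a < x < b ->
  rhos x * derive1 Phi x = - \sum_i xi i 0 * dF i x.
Proof.
move=> [sPhi ePhi Pa Pb] xab; have /andP[ax xb] := xab.
have Uts := param_ball_center; have Tts := UT Uts.
have [g sg rg] : smooth_itv a b (rho ^~ ts) by case: model => _ _ _ + _; apply.
have sP := smooth_derive sPhi.
have derS h : smooth h -> forall y : R, is_derive y 1 h (derive1 h y).
  by move=> sh y; apply: DeriveDef; [exact: (sh 0%N)|rewrite derive1E].
(* With the smooth extension [g] in place of rho the flux is continuously differentiable on the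
   whole line, so the fundamental theorem reaches the endpoint [a], where the equation itself is not
   stated. *)
pose W y := g y * derive1 Phi y.
pose W' y := g y * derive1 (derive1 Phi) y + derive1 Phi y * derive1 g y.
have dW (y : R) : is_derive y 1 W (W' y) by apply: is_deriveM; exact: derS.
have cW : continuous W.
  by move=> y; apply: cvgM; [exact: smooth_continuous sg y|exact: smooth_continuous sP y].
have cW' : continuous W'.
  have c1 := smooth_continuous (smooth_derive sP).
  have c2 := smooth_continuous (smooth_derive sg).
  have c3 := smooth_continuous sg; have c4 := smooth_continuous sP.
  move=> y; apply: cvgD; first by apply: cvgM; [exact: c3|exact: c1].
  by apply: cvgM; [exact: c4|exact: c2].
have W'E y : a < y < b -> W' y = - \sum_i xi i 0 * partial i (rho y) ts.
  move=> yab; have := ePhi y yab; rewrite mxE => eqn.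
  have -> : \sum_i xi i 0 * partial i (rho y) ts =
      \sum_j gradient (rho y) ts 0 j * xi j 0.
    by apply: eq_bigr => i _; rewrite mxE mulrC.
  rewrite -eqn opprK derive1E.
  have [_ <-] := dW y; apply: near_eq_derive; near=> z; rewrite rg//.
  apply: oo_cc; have : z \in `]a, b[%R by near: z; apply: near_in_itvoo; rewrite in_itv.
  by rewrite in_itv.
have iW : \int[mu]_(y in `[a, x]) W' y = W x.
  rewrite /Rintegral (@continuous_FTC2 R W' W)//.
  - by rewrite /W Pa mulr0 -EFinB subr0.
  - exact: continuous_subspaceT.
  - split.
    + by move=> y _; case: (dW y).
    + exact/cvg_at_right_filter/cW.
    + exact/cvg_at_left_filter/cW.
  - by move=> y _; rewrite derive1E; case: (dW y).
rewrite (rg x (oo_cc xab)) -/(W x) -iW.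
have mx : measurable (`[a, x] : set (measurableTypeR R)) by exact: measurable_itv.
rewrite (Rintegral_setD_null mx mZ Z0); last first.
  exact/integrable_segment/continuous_subspaceT.
have -> : `[a, x] `\` Z = Bto x.
  apply/seteqP; split => y /=; rewrite !in_itv/=.
    by move=> [/andP[-> yx] nZ]; rewrite yx (le_trans yx (ltW xb)).
  by move=> [[/andP[-> _] ->]].
rewrite (@eq_Rintegral _ _ _ mu _
  (fun y => \sum_i (- xi i 0) * partial i (rho y) ts)); last first.
  move=> y; rewrite inE => By; rewrite W'E; last first.
    by apply: offnull_oo; case: By => -[? _].
  by rewrite -sumrN; apply: eq_bigr => i _; rewrite mulNr.
have idr i : mu.-integrable (Bto x) (EFin \o (fun y => partial i (rho y) ts)).
  apply: (dominated_integrable (measurable_offnull_to x) Uts) (dominated_partial_model x i).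
  exact: measurable_partial_model.
rewrite Rintegral_sum.
- rewrite -sumrN; apply: eq_bigr => i _.
  by rewrite RintegralZl// ?mulNr ?partial_model_cdfE//; exact: measurable_offnull_to.
- exact: measurable_offnull_to.
- move=> i; apply: integrable_EFinZ => //; exact: measurable_offnull_to.
Unshelve. all: by end_near. Qed.

Definition information : 'M[R]_d :=
  mx_integral `[a, b] (fun x => (rhos x)^-1 *:
    ((gradient (F x) ts)^T *m gradient (F x) ts)).

Lemma informationE i j : information i j =
  \int[mu]_(x in B) ((rhos x)^-1 * (dF i x * dF j x)).
Proof.
rewrite -Rintegral_setD_null//; last exact: integrable_information.
rewrite mxE; apply: eq_Rintegral => x _.
by rewrite !mxE big_ord1 !mxE.
Qed.

(** The integrand is the reciprocal density times the product of the two fluxes. By [neumann_flux]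
    both are linear in the d_i F; their signs cancel and the bilinear form of the matrix remains. *)
Lemma information_is_wasserstein_tensor :
  is_wasserstein_tensor a b rho ts information.
Proof.
move=> xi eta Phi Psi nPhi nPsi.
have Tts := UT param_ball_center.
have sPhi : smooth Phi by case: nPhi.
have sPsi : smooth Psi by case: nPsi.
pose q i j x := (rhos x)^-1 * (dF i x * dF j x).
have iq i j : mu.-integrable B (EFin \o q i j).
  exact: (integrableS mI measurable_offnull offnull_sub (integrable_information i j)).
rewrite (@Rintegral_setD_null _ _ Z)//; last first.
  have [g sg rg] : smooth_itv a b (rho ^~ ts) by case: model => _ _ _ + _; apply.
  apply: (@eq_integrable _ _ _ mu _ mI
    (EFin \o (fun x => g x * derive1 Phi x * derive1 Psi x))).
    by move=> x; rewrite inE/= in_itv/= => xab; rewrite rg.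
  have cPhi := smooth_continuous (smooth_derive sPhi).
  have cPsi := smooth_continuous (smooth_derive sPsi).
  apply/integrable_segment/continuous_subspaceT => x.
  have cg := smooth_continuous sg.
  apply: cvgM; last exact: cPsi.
  by apply: cvgM; [exact: cg|exact: cPhi].
rewrite (@eq_Rintegral _ _ _ mu _
  (fun x => \sum_i \sum_j xi i 0 * eta j 0 * q i j x)); last first.
  have alg (r y1 y2 p1 p2 : R) :
    r * (y1 * p1 * (y2 * p2)) = y1 * y2 * (r * (p1 * p2)) by ring.
  move=> x; rewrite inE => /offnull_oo xab.
  have r0 : rhos x != 0.
    by rewrite gt_eqF//; have [_ + _] := dg; apply; exact: oo_cc.
  have -> : rhos x * derive1 Phi x * derive1 Psi x =
      (rhos x)^-1 * ((rhos x * derive1 Phi x) * (rhos x * derive1 Psi x)).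
    by field.
  rewrite (neumann_flux nPhi xab) (neumann_flux nPsi xab) mulrNN.
  rewrite big_distrlr/= mulr_sumr; apply: eq_bigr => i _.
  rewrite mulr_sumr; apply: eq_bigr => j _; exact: alg.
have iz i j : mu.-integrable B (EFin \o (fun x => xi i 0 * eta j 0 * q i j x)).
  by apply: integrable_EFinZ => //; exact: measurable_offnull.
rewrite Rintegral_sum; [|exact: measurable_offnull|]; last first.
  by move=> i; apply: integrable_EFin_sum => //; exact: measurable_offnull.
rewrite mxE; under eq_bigr do rewrite mxE mulr_suml.
rewrite exchange_big/=; apply: eq_bigr => i _.
rewrite Rintegral_sum//; last exact: measurable_offnull.
apply: eq_bigr => j _; rewrite RintegralZl//; last exact: measurable_offnull.
by rewrite [xi^T _ _]mxE informationE mulrAC.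
Qed.

Lemma risk_has_hessian s : U s -> has_hessian (risk a b rho ts) s.
Proof.
move=> Us i j; split; first by case: (is_derive_risk j Us).
by case: (is_derive_partial_risk i j Us).
Qed.

(** The filter includes [ts] itself, so the value of the Hessian at the truth is covered along with
    the limit. *)
Lemma hessian_risk_cvg : hessian (risk a b rho ts) s @[s --> ts] --> information.
Proof.
apply: (@cvg_matrix R 'rV[R]_d (nbhs ts) d d _ _ (nbhs_filter ts)) => i j.
rewrite informationE.
apply: cvg_near_eq (@integral_risk_curvature_cvg i j).
apply: filterS (nbhs_param_ball param_ball_center) => s Us; rewrite mxE.
by case: (is_derive_partial_risk i j Us).
Qed.

End model.

Unset Implicit Arguments.
Theorem proposition6 (R : realType) (d : nat) (a b : R)
    (Theta : set 'rV[R]_d) (rho : R -> 'rV[R]_d -> R)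
    (ts : 'rV[R]_d) (T : R -> 'rV[R]_d -> R)
    (hab : a < b)
    (hmodel : statistical_model a b Theta rho)
    (hts : Theta ts)
    (hT : forall t, Theta t ->
       optimal_map a b (fun x => rho x t) (fun x => rho x ts) (fun x => T x t))
    (h1 : forall (t : 'rV[R]_d) (xi : 'cV[R]_d), Theta t ->
       exists2 Phi : R -> R,
         neumann_solution a b rho t xi Phi &
         (\int[@lebesgue_measure R]_(x in `[a, b])
            (rho x t * `|derive1 Phi x| ^+ 2)%:E < +oo)%E)
    (hF : forall (x : R) (t : 'rV[R]_d), a <= x <= b -> Theta t ->
       has_hessian (model_cdf a b rho x) t)
    (h2 : forall t0 : 'rV[R]_d, Theta t0 ->
       exists N : set 'rV[R]_d,
         [/\ nbhs t0 N, N `<=` Theta &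
           forall i j : 'I_d,
             [/\ sup_integrable a b N
                   (fun x t => partial i (partial j (model_cdf a b rho x)) t),
                 sup_integrable a b N (fun x t => partial i (rho x) t) &
                 sup_integrable a b N
                   (fun x t => (rho x t)^-1 *
                      `|partial i (model_cdf a b rho x) t
                        * partial j (model_cdf a b rho x) t|)]])
    (h3 : forall t : 'rV[R]_d, Theta t ->
       (forall x : R, a < x < b -> derivable (fun y => T y t) x 1) /\
       exists M : R, forall x : R, a < x < b ->
         `|derive1 (fun y => T y t) x| <= M) :
  let M := mx_integral `[a, b]
    (fun x => (rho x ts)^-1 *:
       ((gradient (model_cdf a b rho x) ts)^T *m gradient (model_cdf a b rho x) ts)) in
  [/\ \forall t \near ts, has_hessian (risk a b rho ts) t,
      hessian (risk a b rho ts) t @[t --> ts^'] --> M &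
      is_wasserstein_tensor a b rho ts M].
Proof.
move=> M.
have [N [Nts NT hN]] := h2 ts hts.
(* A ball inside [N]: being convex, it keeps the segments from [ts] where the bounds hold. *)
have [delta /= delta0 ballN] := (nbhs_ballP _ _).1 Nts.
have UT : (ball ts delta : set 'rV[R]_d) `<=` Theta by move=> s /ballN/NT.
have /choice[G1 G1P] : forall i : 'I_d, exists G : R -> R,
    [/\ forall x, 0 <= G x, (@lebesgue_measure R).-integrable `[a, b] (EFin \o G) &
    {ae @lebesgue_measure R, forall x, a <= x <= b ->
       forall s, N s -> `|partial i (rho x) s| <= G x}].
  by move=> i; have [_ h _] := hN i i; exact: sup_integrable_bound h.
have /choice[G2 G2P] : forall ij : 'I_d * 'I_d, exists G : R -> R,
    [/\ forall x, 0 <= G x, (@lebesgue_measure R).-integrable `[a, b] (EFin \o G) &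
    {ae @lebesgue_measure R, forall x, a <= x <= b -> forall s, N s ->
       `|partial ij.1 (partial ij.2 (model_cdf a b rho x)) s| <= G x}].
  by move=> ij; have [h _ _] := hN ij.1 ij.2; exact: sup_integrable_bound h.
pose P1 x := forall i, a <= x <= b -> forall s, N s ->
  `|partial i (rho x) s| <= G1 i x.
pose P2 x := forall ij, a <= x <= b -> forall s, N s ->
  `|partial ij.1 (partial ij.2 (model_cdf a b rho x)) s| <= G2 ij x.
(* The index types are finite, so a single null set serves all the bounds. *)
have ae12 : {ae @lebesgue_measure R, forall x, P1 x /\ P2 x}.
  have aeF : Filter (almost_everywhere (@lebesgue_measure R)).
    exact: ae_filter_ringOfSetsType.
  have ae1 : almost_everywhere (@lebesgue_measure R) P1.
    by apply: (@filter_forall _ _ _ _ aeF) => i; have [_ _] := G1P i.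
  have ae2 : almost_everywhere (@lebesgue_measure R) P2.
    by apply: (@filter_forall _ _ _ _ aeF) => ij; have [_ _] := G2P ij.
  exact: (@filterI _ _ aeF P1 P2 ae1 ae2).
have [Z [mZ Z0 Za Zb ZP]] := ae_null_set a b ae12.
have G1_ge0 i x : 0 <= G1 i x by have [h _ _] := G1P i.
have iG1 i : (@lebesgue_measure R).-integrable `[a, b] (EFin \o G1 i).
  by have [_ h _] := G1P i.
have rhoG1 x : a <= x <= b -> ~ Z x -> forall i (s : 'rV[R]_d),
    (ball ts delta : set 'rV[R]_d) s -> `|partial i (rho x) s| <= G1 i x.
  by move=> xab /ZP[h _] i s /ballN; exact: h i xab s.
pose H2 i j := G2 (i, j).
have H2_ge0 i j x : 0 <= H2 i j x by have [h _ _] := G2P (i, j); exact: h.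
have iH2 i j : (@lebesgue_measure R).-integrable `[a, b] (EFin \o H2 i j).
  by have [_ h _] := G2P (i, j).
have FH2 x : a <= x <= b -> ~ Z x -> forall i j (s : 'rV[R]_d),
    (ball ts delta : set 'rV[R]_d) s ->
    `|partial i (partial j (model_cdf a b rho x)) s| <= H2 i j x.
  by move=> xab /ZP[_ h] i j s /ballN; exact: (h (i, j) xab s).
have nU : nbhs ts (ball ts delta) by exact: (nbhsx_ballx ts delta delta0).
split.
- apply: filterS nU => s.
  exact: (risk_has_hessian hab hmodel delta0 UT mZ Z0 Za Zb G1_ge0 iG1 rhoG1 hF
    H2_ge0 iH2 FH2).
(* Convergence along full neighbourhoods restricts to punctured ones. *)
- apply: (cvg_trans _ (hessian_risk_cvg hab hmodel delta0 UT mZ Z0 Za Zb G1_ge0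
    iG1 rhoG1 hF H2_ge0 iH2 FH2)).
  by apply: cvg_app; exact: cvg_within.
- exact: (information_is_wasserstein_tensor hab hmodel delta0 UT mZ Z0 Za Zb
    G1_ge0 iG1 rhoG1).
Qed.
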